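(* \begin{enumerate} \item Let $G(M)$ be a topological group which is $\emptyset$-definable as a group in a structure $M$, and assume that the members of a basis of (not necessarily open) neighborhoods of the identity in $G(M)$ are definable in $M$. If $G(M)$ is definably topologically amenable, then $G^{00}_{\mathrm{def},\mathrm{top}}=G^{000}_{\mathrm{def},\mathrm{top}}$. \item Let $G(M)$ be a topological group, regarded as a group $\emptyset$-definable in a structure $M$ in which all open subsets of $G(M)$ are $\emptyset$-definable. If $G(M)$ is amenable as a topological group, then $G^{00}_{\mathrm{top}}=G^{000}_{\mathrm{top}}$. \end{enumerate}
   Context: Let $M^*\succ M$ be a monster model ($\kappa$-saturated and strongly $\kappa$-homogeneous for a sufficiently large $\kappa$; bounded means of cardinality $<\kappa$), and $G=G(M^* )$. $G^{00}_M$ is the smallest $M$-type-definable subgroup of $G$ of bounded index; $G^{000}_M$ is the smallest $\mathrm{Aut}(M^*/M)$-invariant subgroup of $G$ of bounded index. Let $\mu$ be the intersection of all sets $U(M^* )$, where $U(M)$ ranges over all $M$-definable neighborhoods of the identity in $G(M)$; it is a subgroup of $G$ (the infinitesimals), normalized by $G(M)$. Let $\mu^G=\{gag^{-1}:a\in\mu,\ g\in G\}$ and let $\langle\mu^G\rangle$ be the subgroup generated by it. In the setting of (1): $G^{00}_{\mathrm{def},\mathrm{top}}:=\mu\cdot G^{00}_M$ and $G^{000}_{\mathrm{def},\mathrm{top}}:=\langle\mu^G\rangle\cdot G^{000}_M$ (all computed in the language of $M$). $S^\mu_G(M):=S_G(M)/{\sim_\mu}$, where $S_G(M)$ is the space of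 complete types over $M$ concentrated on $G$ and $p\sim_\mu q$ iff $\mu\cdot p=\mu\cdot q$ (types being identified with their sets of realizations in $M^*$); it is a compact space on which $G(M)$ acts by $g*(\mu\cdot p)=\mu\cdot(g\cdot p)$. $G(M)$ is definably topologically amenable if there is a $G(M)$-invariant (i.e. left-invariant), Borel probability measure on $S^\mu_G(M)$. In the setting of (2): $G^{00}_{\mathrm{top}}:=\mu\cdot G^{00}_M$ and $G^{000}_{\mathrm{top}}:=\langle\mu^G\rangle\cdot G^{000}_M$. The topological group $G(M)$ is amenable if every compact Hausdorff space with a jointly continuous action of $G(M)$ carries a $G(M)$-invariant, Borel probability measure. *)

(* Defs.v *)
From HB Require Import structures.
From mathcomp Require Import all_boot all_order all_algebra.
From mathcomp Require Import all_classical all_reals all_analysis.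

Set Implicit Arguments.
Unset Strict Implicit.
Unset Printing Implicit Defensive.

Local Open Scope classical_set_scope.
Local Open Scope card_scope.
Local Open Scope group_scope.
Local Open Scope quotient_scope.

Record signature := Signature {
  fsym : Type; farity : fsym -> nat;
  rsym : Type; rarity : rsym -> nat }.

Record structure (L : signature) := Structure {
  carrier :> Type;
  finterp : forall f : fsym L, ('I_(farity f) -> carrier) -> carrier;
  rinterp : forall r : rsym L, ('I_(rarity r) -> carrier) -> Prop }.

(* Free variables are indexed by an arbitrary type [V]; under a quantifier the
   bound variable is [None].  An L-formula in the variables [X] with parameters
   from [A] is a formula over [X + A], each parameter being a variable
   that is always interpreted by itself. *)
Inductive term (L : signature) (V : Type) : Type :=
| Var of V
| App (f : fsym L) of ('I_(farity f) -> term L V).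

Inductive formula (L : signature) (V : Type) : Type :=
| Bot
| Eq of term L V & term L V
| Rel (r : rsym L) of ('I_(rarity r) -> term L V)
| Imp of formula L V & formula L V
| All of formula L (option V).

Definition Neg L V (phi : formula L V) : formula L V := Imp phi (Bot L V).

Fixpoint trename L V W (f : V -> W) (t : term L V) : term L W :=
  match t with
  | Var v => Var L (f v)
  | App s ts => App (fun i => trename f (ts i))
  end.

Fixpoint frename L V W (f : V -> W) (phi : formula L V) : formula L W :=
  match phi with
  | Bot => Bot L W
  | Eq t u => Eq (trename f t) (trename f u)
  | Rel r ts => Rel (fun i => trename f (ts i))
  | Imp a b => Imp (frename f a) (frename f b)
  | All a => All (frename (omap f) a)
  end.

Definition scons (N V : Type) (x : N) (v : V -> N) (o : option V) : N :=
  if o is Some i then v i else x.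

Fixpoint teval L (N : structure L) V (v : V -> N) (t : term L V) : N :=
  match t with
  | Var i => v i
  | App f ts => finterp (fun i => teval v (ts i))
  end.

Fixpoint sat L (N : structure L) V (v : V -> N) (phi : formula L V) : Prop :=
  match phi with
  | Bot => False
  | Eq t u => teval v t = teval v u
  | Rel r ts => rinterp (fun i => teval v (ts i))
  | Imp a b => sat v a -> sat v b
  | All a => forall x : N, sat (scons x v) a
  end.

Lemma teval_rename L (N : structure L) V W (f : V -> W) (v : W -> N)
  (t : term L V) : teval v (trename f t) = teval (v \o f) t.
Proof. by elim: t => //= s ts IH; congr finterp; apply/funext => i; exact: IH. Qed.

Lemma sat_rename L (N : structure L) V W (f : V -> W) (v : W -> N)
  (phi : formula L V) : sat v (frename f phi) <-> sat (v \o f) phi.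
Proof.
elim: phi W f v => {V} [V|V t u|V r ts|V a IHa b IHb|V a IH] W f v //=.
- by rewrite !teval_rename.
- suff -> : (fun i => teval v (trename f (ts i))) =
            (fun i => teval (v \o f) (ts i)) by [].
  by apply/funext => i; exact: teval_rename.
- by rewrite IHa IHb.
- suff E x : scons x v \o omap f = scons x (v \o f).
    by split=> H x; move: (H x); rewrite IH E.
  by apply/funext => -[].
Qed.

Definition elementary L (N N' : structure L) (j : N -> N') : Prop :=
  forall (V : Type) (phi : formula L V) (v : V -> N),
    sat v phi <-> sat (j \o v) phi.

Definition automorphism L (N : structure L) (s : N -> N) : Prop :=
  [/\ bijective s,
      forall (f : fsym L) xs, s (finterp (f := f) xs) = finterp (s \o xs)
    & forall (r : rsym L) xs, rinterp (r := r) (s \o xs) <-> rinterp xs].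

Definition card_lt T U (A : set T) (B : set U) : Prop :=
  (A #<= B) /\ ~ (B #<= A).

(* A cardinal kappa is represented by a type [K] of that cardinality. *)
Definition saturated (K : Type) L (N : structure L) : Prop :=
  forall A : set N, card_lt A [set: K] ->
  forall p : set (formula L (option A)),
    (forall F, F `<=` p -> finite_set F ->
      exists x : N, forall phi, F phi -> sat (scons x val) phi) ->
    exists x : N, forall phi, p phi -> sat (scons x val) phi.

Definition strongly_homogeneous (K : Type) L (N : structure L) : Prop :=
  forall (A : set N) (f : A -> N), card_lt A [set: K] ->
    (forall phi : formula L A, sat val phi <-> sat f phi) ->
    exists2 s : N -> N, automorphism s & forall a : A, s (val a) = f a.

HB.mixin Record isTopGroup G & Group G & Topological G := {
  mulg_cts : continuous (fun x : (G * G)%type => x.1 * x.2);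
  invg_cts : continuous (fun x : G => x^-1) }.

#[short(type="topGroupType")]
HB.structure Definition TopGroup := {G of Group G & Topological G & isTopGroup G}.

Definition env (A B N : Type) (u : A -> N) (v : B -> N) (i : A + B) : N :=
  match i with inl a => u a | inr b => v b end.

(* Through [c], the group [H] is the group whose universe is the subset of
   N^n defined by [dom] and whose multiplication has the graph defined
   by [mul]. *)
Definition group_defined_by L (N : structure L) (n : nat)
  (dom : formula L 'I_n) (mul : formula L ('I_n + 'I_n + 'I_n))
  (H : groupType) (c : H -> 'I_n -> N) : Prop :=
  [/\ injective c,
      range c = [set x | sat x dom]
    & forall a b d : H, sat (env (env (c a) (c b)) (c d)) mul <-> a * b = d].

(* A topological group G(M), 0-definable as a group in [M], an elementary
   extension [Mstar] of [M], and the group G(Mstar) defined in [Mstar] by the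
   same formulas. *)
Record defGroup (L : signature) := DefGroup {
  M : structure L;
  Mstar : structure L;
  emb : M -> Mstar;
  dim : nat;
  domF : formula L 'I_dim;
  mulF : formula L ('I_dim + 'I_dim + 'I_dim);
  GM : topGroupType;
  coordM : GM -> 'I_dim -> M;
  GMstar : groupType;
  coord : GMstar -> 'I_dim -> Mstar;
  emb_elementary : elementary emb;
  GM_definable : group_defined_by domF mulF coordM;
  GMstar_definable : group_defined_by domF mulF coord }.

(* [Mstar] is kappa-saturated and strongly kappa-homogeneous, for kappa larger
   than 2^(|L| + |M| + aleph_0). *)
Definition monster (K : Type) L (S : defGroup L) : Prop :=
  [/\ card_lt [set: set (fsym L + rsym L + M S + nat)] [set: K],
      saturated K (Mstar S)
    & strongly_homogeneous K (Mstar S)].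

Definition Mformula L (S : defGroup L) := formula L ('I_(dim S) + M S).

Definition defM L (S : defGroup L) (phi : Mformula S) : set (GM S) :=
  [set g | sat (env (coordM g) id) phi].

Definition defMstar L (S : defGroup L) (phi : Mformula S) : set (GMstar S) :=
  [set a | sat (env (coord a) (@emb L S)) phi].

(* The inclusion of G(M) in G(Mstar); the default value 1 is never taken, since
   [emb] is elementary. *)
Definition incl L (S : defGroup L) (g : GM S) : GMstar S :=
  xget 1 [set a | coord a = @emb L S \o coordM g].

Definition mulset (H : groupType) (A B : set H) : set H :=
  [set a * b | a in A & b in B].

Definition subgroup (H : groupType) (A : set H) : Prop :=
  [/\ A 1, forall x y, A x -> A y -> A (x * y) & forall x, A x -> A x^-1].

Definition bounded_index (K : Type) (H : groupType) (A : set H) : Prop :=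
  card_lt (range (fun g : H => [set g * a | a in A])) [set: K].

Definition M_type_definable L (S : defGroup L) (A : set (GMstar S)) : Prop :=
  exists p : set (Mformula S), A = \bigcap_(phi in p) defMstar phi.

Definition M_invariant L (S : defGroup L) (A : set (GMstar S)) : Prop :=
  forall s : Mstar S -> Mstar S, automorphism s ->
    (forall m : M S, s (emb m) = emb m) ->
    (fun x => s \o x) @` (@coord L S @` A) = @coord L S @` A.

Definition G00 (K : Type) L (S : defGroup L) : set (GMstar S) :=
  smallest [set A : set (GMstar S) |
    [/\ subgroup A, M_type_definable A & bounded_index K A]] set0.
Arguments G00 K {L} S _.

Definition G000 (K : Type) L (S : defGroup L) : set (GMstar S) :=
  smallest [set A : set (GMstar S) |
    [/\ subgroup A, M_invariant A & bounded_index K A]] set0.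
Arguments G000 K {L} S _.

Definition mu L (S : defGroup L) : set (GMstar S) :=
  \bigcap_(phi in [set phi : Mformula S | nbhs (1 : GM S) (defM phi)]) defMstar phi.
Arguments mu {L} S _.

Definition mu_conj L (S : defGroup L) : set (GMstar S) :=
  [set g * a * g^-1 | a in mu S & g in [set: GMstar S]].
Arguments mu_conj {L} S _.

Definition G00_top (K : Type) L (S : defGroup L) : set (GMstar S) :=
  mulset (mu S) (G00 K S).
Arguments G00_top K {L} S _.

Definition G000_top (K : Type) L (S : defGroup L) : set (GMstar S) :=
  mulset (smallest (@subgroup (GMstar S)) (mu_conj S)) (G000 K S).
Arguments G000_top K {L} S _.

(* Since M is an elementary substructure of Mstar, consistency with the
   elementary diagram of M is finite satisfiability in Mstar. *)
Record gtype L (S : defGroup L) := GType {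
  gtype_set : set (Mformula S);
  gtype_consistent : forall F, F `<=` gtype_set -> finite_set F ->
    exists x : 'I_(dim S) -> Mstar S,
      forall phi, F phi -> sat (env x (@emb L S)) phi;
  gtype_complete : forall phi, gtype_set phi \/ gtype_set (Neg phi);
  gtype_conc : gtype_set (frename inl (domF S)) }.

Section TypeOf.
Context (L : signature) (S : defGroup L) (a : GMstar S).

Let T : set (Mformula S) := [set phi | defMstar phi a].

Fact tp_consistent F : F `<=` T -> finite_set F ->
  exists x : 'I_(dim S) -> Mstar S,
    forall phi, F phi -> sat (env x (@emb L S)) phi.
Proof. by move=> FT _; exists (coord a) => phi /FT. Qed.

Fact tp_complete phi : T phi \/ T (Neg phi).
Proof. by have [|] := pselect (T phi); [left | right]. Qed.

Fact tp_conc : T (frename inl (domF S)).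
Proof.
apply/sat_rename; have [_ cG _] := GMstar_definable S.
suff : [set x | sat x (domF S)] (coord a) by [].
by rewrite -cG; exists a.
Qed.

Definition tp : gtype S := GType tp_consistent tp_complete tp_conc.

End TypeOf.

Definition realizations L (S : defGroup L) (p : gtype S) : set (GMstar S) :=
  \bigcap_(phi in gtype_set p) defMstar phi.

HB.instance Definition _ L (S : defGroup L) := gen_eqMixin (gtype S).
HB.instance Definition _ L (S : defGroup L) := gen_choiceMixin (gtype S).
HB.instance Definition _ L (S : defGroup L) := isPointed.Build (gtype S) (tp 1).
HB.instance Definition _ L (S : defGroup L) :=
  isSubBaseTopological.Build (gtype S)
    (range (fun phi : Mformula S => [set p : gtype S | gtype_set p phi])) id.

(* g . p is the type of g * a for a realizing p; this does not depend on the
   choice of a, which exists as soon as Mstar is |M + L|^+-saturated. *)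
Definition gtype_act L (S : defGroup L) (g : GM S) (p : gtype S) : gtype S :=
  tp (incl g * xget 1 (realizations p)).

Definition mu_equiv L (S : defGroup L) (p q : gtype S) : bool :=
  `[< mulset (mu S) (realizations p) = mulset (mu S) (realizations q) >].

Fact mu_equiv_equiv L (S : defGroup L) : equiv_class_of (@mu_equiv L S).
Proof.
split=> [p|p q|q p r].
- exact/asboolP.
- by apply/asboolP/asboolP.
- by move=> /asboolP pq /asboolP qr; apply/asboolP; rewrite pq.
Qed.

Canonical mu_equiv_canonical L (S : defGroup L) :=
  EquivRelPack (@mu_equiv_equiv L S).

Definition Smu L (S : defGroup L) : ptopologicalType :=
  quotient_topology {eq_quot (@mu_equiv L S)}.

(* G(M) normalizes mu, so the class of g . p depends only on that of p. *)
Definition Smu_act L (S : defGroup L) (g : GM S) (x : Smu S) : Smu S :=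
  \pi_(quotient_topology {eq_quot (@mu_equiv L S)}) (gtype_act g (repr x)).

Definition borel (X : ptopologicalType) := g_sigma_algebraType (@open X).

Definition has_invariant_probability (R : realType) (I : Type)
  (X : ptopologicalType) (act : I -> X -> X) : Prop :=
  exists P : probability (borel X) R,
    forall (g : I) (B : set (borel X)), measurable B -> P (act g @^-1` B) = P B.

Definition definably_topologically_amenable (R : realType) L (S : defGroup L) :
  Prop := has_invariant_probability R (@Smu_act L S).

(* Pointed spaces, because a compact space carrying a probability measure must
   be nonempty. *)
Definition amenable (R : realType) (H : topGroupType) : Prop :=
  forall (X : ptopologicalType) (act : H -> X -> X),
    compact [set: X] -> hausdorff_space X ->
    (forall x, act 1 x = x) ->
    (forall g h x, act (g * h) x = act g (act h x)) ->
    continuous (fun z : (H * X)%type => act z.1 z.2) ->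
    has_invariant_probability R act.

Definition definable_basis L (S : defGroup L) : Prop :=
  forall U : set (GM S), nbhs (1 : GM S) U ->
    exists2 phi : Mformula S, nbhs (1 : GM S) (defM phi) & defM phi `<=` U.

Definition opens_0definable L (S : defGroup L) : Prop :=
  forall U : set (GM S), open U ->
    exists phi : formula L 'I_(dim S), U = [set g | sat (coordM g) phi].

(* Main.v *)
(* Let E be the set of all a^-1 b with a, b of the same type over M, and N the
   subgroup generated by E.  Coheirs show that E is contained in every
   M-invariant subgroup of bounded index, that N is normal, and that mu N
   contains all conjugates of mu.  Hence both statements follow once mu N is
   type-definable over M, for then it contains G00.

   The invariant measure on S^mu_G(M) induces a left-invariant mean rho on the
   lattice of the type-definable sets Y with mu Y = Y.  The Massicot-Wagner
   argument is run for rho, except that "measure at least t" is replaced by a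
   first-order notion of largeness: among any N translates of the set, two have
   a large intersection.  If B is large and rho (mu B Z) is almost minimal, then
   D = {g : gB cap B large} almost stabilizes mu B Z, and D is definable in the
   language of M itself.  Finitely many translates of D by elements of G(M) cover
   G, so E is contained in D^-1 D, and all products of elements of E lie in
   V V (X X^-1)^3 V^-1 V^-1, for each definable neighbourhood V of 1 and each
   definable X with rho (mu X) > 0.  Let V shrink to mu and X to a type all of
   whose members have positive mean: the intersection of the sets
   V V V (X X^-1)^3 V^-1 V^-1 is mu N.

   For an amenable topological group, S^mu_G(M) is a compact Hausdorff space with
   a jointly continuous action, which reduces (2) to (1). *)
From Stdlib Require List.
From mathcomp Require Import all_boot all_order all_algebra.
From mathcomp Require Import all_classical all_reals all_analysis.
From mathcomp Require Import ring lra.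
Require Import Defs.

Set Implicit Arguments.
Unset Strict Implicit.
Unset Printing Implicit Defensive.

Import Order.TTheory GRing.Theory Num.Theory.
Import numFieldNormedType.Exports.

Local Open Scope classical_set_scope.
Local Open Scope card_scope.
Local Open Scope group_scope.

(** * Cardinals *)

(** The obstacle is that the mean [rho] lives on type-definable sets and is invariant only under
    G(M): a set of the form {g : rho (Y cap gY) >= r} need not be definable, and nothing said about
    it could be carried to G(Mstar). Largeness concerns definable sets alone, so the covering and
    the inclusions between products transfer by elementarity, while [rho] is compared only along
    translates by G(M). The exponent 3 comes from Y = mu B Z with B inside V X and Z = X^-1 X: if Y
    meets gY, then g is in Y Y^-1, hence in mu V X X^-1 X (mu V X X^-1 X)^-1. The factor Z keeps rho
    Y away from 0 however small B becomes, since b Z contains a translate of X. The bound on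
    products of elements of E must not depend on their number, for only then does it hold for all of
    N; the number affects only how closely D has to stabilize Y. Since kappa is given by a bare
    type, the cardinal arithmetic of infinite types is derived from Zorn's lemma. *)

Lemma sval_inj (T : Type) (P : T -> Prop) : injective (@sval T P).
Proof. by move=> [x Px] [y Py] /= xy; exact: eq_exist. Qed.

Lemma ex_pick (T : Type) (d : T) : exists c : set T -> T, forall P x, P x -> P (c P).
Proof.
exists (fun P => if pselect (exists x, P x) is left h then sval (cid h) else d).
by move=> P x Px; case: pselect => [h|[]]; [exact: svalP|exists x].
Qed.

(** Zorn's lemma for partial injections, each a domain with a total function whose values off the
    domain are ignored. A maximal one is total or onto, as otherwise one more pair could be added;
    an onto one is inverted by choice. *)
Lemma inj_total (T U : Type) :
  (exists f : T -> U, injective f) \/ (exists f : U -> T, injective f).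
Proof.
have [[u0 _]|U0] := pselect (exists u : U, True); last first.
  have N (u : U) : False by apply: U0; exists u.
  by right; exists (fun u => False_rect _ (N u)) => u; case: (N u).
pose D := {p : set T * (T -> U) |
  forall x y, p.1 x -> p.1 y -> p.2 x = p.2 y -> x = y}.
pose R (p q : D) : bool :=
  `[< (sval p).1 `<=` (sval q).1 /\
      forall x, (sval p).1 x -> (sval p).2 x = (sval q).2 x >].
have e0 (x y : T) : set0 x -> set0 y -> u0 = u0 -> x = y by [].
have [|||p pmax] := @ZL_preorder D (exist _ (set0, fun=> u0) e0) R.
- by move=> p; apply/asboolP; split.
- move=> p q r /asboolP[pq pqE] /asboolP[qr qrE]; apply/asboolP; split.
    exact: subset_trans qr.
  by move=> x px; rewrite pqE // qrE //; exact: pq.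
- move=> F totF.
  have [c cP] := ex_pick (exist _ (set0, fun=> u0) e0 : D).
  pose r x := c [set p : D | F p /\ (sval p).1 x].
  pose A := [set x | exists p : D, F p /\ (sval p).1 x].
  have rP x : A x -> F (r x) /\ (sval (r x)).1 x.
    by move=> [p Fp]; exact: (cP [set p : D | F p /\ (sval p).1 x] p).
  have E p x : F p -> (sval p).1 x -> (sval (r x)).2 x = (sval p).2 x.
    move=> Fp px; have [Fr rx] := rP x (ex_intro _ p (conj Fp px)).
    have [/asboolP[_ ->]//|/asboolP[_ <-]//] := totF _ _ Fr Fp.
  have injA x y : A x -> A y -> (sval (r x)).2 x = (sval (r y)).2 y -> x = y.
    move=> /rP[Fx xx] /rP[Fy yy].
    have [/asboolP[H HE]|/asboolP[H HE]] := totF _ _ Fx Fy.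
      by rewrite HE //; apply: (svalP (r y)) => //; exact: H.
    by rewrite (HE y) //; apply: (svalP (r x)) => //; exact: H.
  exists (exist _ (A, fun x => (sval (r x)).2 x) injA) => p Fp.
  apply/asboolP; split=> [x px|x px] /=; first by exists p.
  by rewrite (E p).
case: p pmax => -[A f] /= fI pmax.
have [AT|/existsNP[x0 Ax0]] := pselect (forall x, A x).
  by left; exists f => x y; apply: (fI).
have [fU|/existsNP[u fu]] := pselect (forall u, exists2 x, A x & f x = u).
  have /choice[g gP] : forall u, exists x, A x /\ f x = u.
    by move=> u; have [x Ax fx] := fU u; exists x.
  right; exists g => u v gE; have [_ <-] := gP u; have [_ <-] := gP v.
  by rewrite gE.
have newI x y : (A `|` [set x0]) x -> (A `|` [set x0]) y ->
    (if pselect (x = x0) then u else f x) =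
    (if pselect (y = x0) then u else f y) -> x = y.
  move=> Ax Ay; case: pselect => xx0; case: pselect => yx0 /=.
  - by rewrite xx0 yx0.
  - by case: Ay => // Ay /esym fy; case: fu; exists y.
  - by case: Ax => // Ax fx; case: fu; exists x.
  - by case: Ax => // Ax; case: Ay => // Ay; exact: (fI).
pose q : D := exist _ (A `|` [set x0],
   fun x => if pselect (x = x0) then u else f x) newI.
have /pmax/asboolP[/(_ x0) /= H _] : R (exist _ (A, f) fI) q.
  apply/asboolP; split=> [x ?|x /= Ax]; first by left.
  by case: pselect => //= xx0; case: Ax0; rewrite -xx0.
by case: Ax0; apply: H; right.
Qed.

(* Zorn's lemma for pairings defined on a subset: at a maximal one, the
   complement of the subset is not larger than the subset itself. *)
Lemma infinite_pairing (T : Type) (e : nat -> T) : injective e ->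
  exists f : T -> T -> T, forall x y x' y', f x y = f x' y' -> x = x' /\ y = y'.
Proof.
move=> eI.
pose good (p : set T * (T -> T -> T)) :=
  [/\ forall n, p.1 (e n),
      forall x y, p.1 x -> p.1 y -> p.1 (p.2 x y)
    & forall x y x' y', p.1 x -> p.1 y -> p.1 x' -> p.1 y' ->
        p.2 x y = p.2 x' y' -> x = x' /\ y = y'].
pose D := {p | good p}.
pose R (p q : D) : bool :=
  `[< (sval p).1 `<=` (sval q).1 /\
      forall x y, (sval p).1 x -> (sval p).1 y ->
        (sval p).2 x y = (sval q).2 x y >].
have [e' e'K] : exists e' : T -> nat, cancel e e'.
  exists (fun x => xget 0 [set n | e n = x]) => n.
  by apply: xget_unique => //= m /eI.
have g0 : good (range e, fun x y => e (pickle (e' x, e' y))).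
  split=> /=.
  - by move=> n; exists n.
  - by move=> x y _ _; exists (pickle (e' x, e' y)).
  - move=> _ _ _ _ [m _ <-] [n _ <-] [m' _ <-] [n' _ <-].
    by rewrite !e'K => /eI/(pcan_inj pickleK)[-> ->].
pose p0 : D := exist _ _ g0.
have [|||p pmax] := @ZL_preorder D p0 R.
- by move=> p; apply/asboolP; split.
- move=> p q r /asboolP[pq pqE] /asboolP[qr qrE]; apply/asboolP; split.
    exact: subset_trans qr.
  by move=> x y px py; rewrite pqE // qrE //; exact: pq.
- move=> F totF.
  have [[p1 Fp1]|F0] := pselect (exists p, F p); last first.
    by exists p0 => p Fp; case: F0; exists p.
  pose A := [set x | exists p : D, F p /\ (sval p).1 x].
  have AA x y : A x -> A y -> exists p : D, [/\ F p, (sval p).1 x & (sval p).1 y].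
    move=> [p [Fp px]] [q [Fq qy]].
    have [/asboolP[pq _]|/asboolP[qp _]] := totF _ _ Fp Fq.
      by exists q; split => //; exact: pq.
    by exists p; split => //; exact: qp.
  have [c cP] := ex_pick p0.
  pose r x y := c [set p : D | [/\ F p, (sval p).1 x & (sval p).1 y]].
  have rP x y : A x -> A y -> [/\ F (r x y), (sval (r x y)).1 x & (sval (r x y)).1 y].
    move=> Ax Ay; have [p Hp] := AA _ _ Ax Ay.
    exact: (cP [set p : D | [/\ F p, (sval p).1 x & (sval p).1 y]] p).
  pose f x y := (sval (r x y)).2 x y.
  have E p x y : F p -> (sval p).1 x -> (sval p).1 y -> f x y = (sval p).2 x y.
    move=> Fp px py.
    have [||Fr rx ry] := rP x y; [by exists p|by exists p|].
    by have [/asboolP[_ H]|/asboolP[_ H]] := totF _ _ Fr Fp; rewrite /f H.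
  have gA : good (A, f).
    split=> /=.
    - by move=> n; exists p1; split => //; case: (svalP p1).
    - move=> x y Ax Ay; have [p [Fp px py]] := AA _ _ Ax Ay.
      rewrite (E p) //; exists p; split => //.
      by case: (svalP p) => _ + _; exact.
    - move=> x y x' y' Ax Ay Ax' Ay'.
      have [p [Fp px py]] := AA _ _ Ax Ay.
      have [q [Fq qx qy]] := AA _ _ Ax' Ay'.
      rewrite (E p) // (E q) //.
      have [/asboolP[pq pqE]|/asboolP[qp qpE]] := totF _ _ Fp Fq.
        rewrite pqE //; case: (svalP q) => _ _; apply => //; exact: pq.
      rewrite qpE //; case: (svalP p) => _ _; apply => //; exact: qp.
  exists (exist _ _ gA) => p Fp; apply/asboolP; split=> [x px|x y px py] /=.
    by exists p.
  by rewrite (E p).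
case: p pmax => -[A f] gf pmax; have [/= Ae Af fI] := gf.
pose CA := {x | ~ A x}.
have [[h hI]|[j jI]] := inj_total CA {x | A x}.
  (* The complement of [A] embeds in [A], so all of [T] does, with [e 0] and [e 1] keeping the two
     halves apart; the pairing of [A] is pulled back. *)
  pose i x : T := if pselect (A x) is right nA then f (e 0%N) (sval (h (exist _ x nA)))
                  else f (e 1%N) x.
  have iA x : A (i x).
    rewrite /i; case: pselect => [Ax|nA]; first exact: (Af).
    by apply: (Af) => //; exact: svalP.
  have iI : injective i.
    move=> x y; rewrite /i; case: pselect => [Ax|nAx]; case: pselect => [Ay|nAy].
    - by move=> /(fI) [].
    - by move=> /(fI) []// ; [exact: svalP|move/eI].
    - by move=> /(fI) []// ; [exact: svalP|move/eI].
    - move=> /(fI) []//; [exact: svalP|exact: svalP|move=> _ E].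
      by have /hI/(congr1 sval) := sval_inj E.
  by exists (fun x y => f (i x) (i y)) => x y x' y' /fI [] // /iI -> /iI ->.
(* Otherwise the complement contains a copy [B] of [A], and the pairing extends to their union,
   against maximality. *)
pose B := range (sval \o j).
have BA x : B x -> ~ A x by move=> [y _ <-]; exact: (svalP (j y)).
have [c cP] := ex_pick (e 0).
pose g x : T := c [set y | exists Ay : A y, sval (j (exist _ y Ay)) = x].
have gB x : B x -> A (g x) /\ exists Ay : A (g x), sval (j (exist _ (g x) Ay)) = x.
  move=> [[y Ay] _ /= yx].
  have [Ag H] : [set y | exists Ay : A y, sval (j (exist _ y Ay)) = x] (g x).
    by apply: (cP _ y); exists Ay.
  by split => //; exists Ag.
have gI x y : B x -> B y -> g x = g y -> x = y.
  move=> /gB[_ [Ax Ex]] /gB[_ [Ay Ey]] gxy.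
  by apply: (etrans (esym Ex)); apply: etrans Ey; congr (sval (j _)); apply: sval_inj.
(* A pair not inside [A] is folded into [A] by [hat], coded there with a [tag] telling which
   coordinates lay in [A], and moved to [B] by [jj]. *)
pose tag (x y : T) : T := e (if pselect (A x) then 0%N else if pselect (A y) then 1%N else 2%N).
pose hat x := if pselect (A x) then x else g x.
have hatA x : (A `|` B) x -> A (hat x).
  by rewrite /hat; case: pselect => // nA [//|/gB[]].
have tA x y : A (tag x y) by exact: (Ae).
pose ff x y := f (tag x y) (f (hat x) (hat y)).
have ffA x y : (A `|` B) x -> (A `|` B) y -> A (ff x y).
  by move=> xAB yAB; apply: (Af) => //; apply: (Af); exact: hatA.
pose jj x : T := if pselect (A x) is left Ax then sval (j (exist _ x Ax)) else x.
have jjB x : A x -> B (jj x).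
  by move=> Ax; rewrite /jj; case: pselect => // Ax'; exists (exist _ x Ax').
have jjI x y : A x -> A y -> jj x = jj y -> x = y.
  rewrite /jj; case: pselect => // Ax; case: pselect => // Ay _ _ /sval_inj/jI.
  by move/(congr1 sval).
pose f' x y := if pselect (A x /\ A y) then f x y else jj (ff x y).
have gf' : good (A `|` B, f').
  split=> /=.
  - by move=> n; left.
  - move=> x y xAB yAB; rewrite /f'; case: pselect => [[Ax Ay]|nA].
      by left; exact: (Af).
    by right; apply: jjB; exact: ffA.
  - move=> x y x' y' hx hy hx' hy'; rewrite /f'.
    case: pselect => [[Ax Ay]|nxy]; case: pselect => [[Ax' Ay']|nxy'] /=.
    + exact: (fI).
    + by move=> E; have [] := BA _ (jjB _ (ffA _ _ hx' hy')); rewrite -E; exact: (Af).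
    + by move=> E; have [] := BA _ (jjB _ (ffA _ _ hx hy)); rewrite E; exact: (Af).
    + move/jjI; have fA := fun a b ha hb => Af _ _ (hatA a ha) (hatA b hb).
      move=> /(_ (ffA _ _ hx hy) (ffA _ _ hx' hy')) E.
      have [/eI E1 E2] := fI _ _ _ _ (tA _ _) (fA _ _ hx hy) (tA _ _) (fA _ _ hx' hy') E.
      have [] := fI _ _ _ _ (hatA _ hx) (hatA _ hy) (hatA _ hx') (hatA _ hy') E2.
      have h1 a a' : (A `|` B) a -> (A `|` B) a' -> (A a <-> A a') ->
          hat a = hat a' -> a = a'.
        move=> ha ha' AA'; rewrite /hat.
        case: pselect => Aa; case: pselect => Aa' //=; try tauto.
        by case: ha ha' => // Ba [//|Ba']; exact: gI.
      move=> Hx Hy; move: E1.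
      case: (pselect (A x)) => Ax; case: (pselect (A x')) => Ax' /=.
      * case: (pselect (A y)) => Ay; first by case: nxy.
        case: (pselect (A y')) => Ay'; first by case: nxy'.
        by move=> _; split; apply: h1.
      * by case: (pselect (A y')).
      * by case: (pselect (A y)).
      * by case: (pselect (A y)) => Ay; case: (pselect (A y')) => Ay' //= _;
          split; apply: h1.
have /pmax/asboolP[/= H _] : R (exist _ _ gf) (exist _ _ gf').
  apply/asboolP; split=> [x ?|x y /= Ax Ay]; first by left.
  by rewrite /f'; case: pselect => //= -[].
have /(BA _)[] := jjB _ (Ae 0).
by apply: H; right; exact: jjB.
Qed.

Lemma card_le_injP T U (A : set T) (B : set U) :
  A #<= B <-> exists f : A -> B, injective f.
Proof.
split=> [/card_leP[f]|[f fI]].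
  by exists f => x y; apply: (@inj _ _ _ f); rewrite inE.
apply/card_leP/injfunPex; exists f => // x y _ _; exact: fI.
Qed.

Lemma card_leT_inj T U (f : T -> U) : injective f -> [set: T] #<= [set: U].
Proof.
move=> fI; apply/card_le_injP; exists (fun x => exist _ (f (val x)) (mem_set I)).
by move=> x y [] /fI/val_inj.
Qed.

Lemma inj_card_leT T U : [set: T] #<= [set: U] -> exists f : T -> U, injective f.
Proof.
move=> /card_le_injP[f fI].
exists (fun x => val (f (exist _ x (mem_set I)))) => x y /val_inj/fI.
by move=> [].
Qed.

Lemma card_lt_le K T U (A : set T) (B : set U) :
  A #<= B -> card_lt B [set: K] -> card_lt A [set: K].
Proof.
move=> AB [BK KB]; split; first exact: card_le_trans BK.
by move=> KA; apply: KB; exact: card_le_trans AB.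
Qed.

(** If [K] embeds in the union, split [K] into rows by the pairing. Either some row goes entirely
    into [A], or every row has a point sent into [B]; so [K] embeds in [A] or in [B]. *)
Lemma card_lt_setU K (e : nat -> K) T (A B : set T) : injective e ->
  card_lt A [set: K] -> card_lt B [set: K] -> card_lt (A `|` B) [set: K].
Proof.
move=> eI [/card_le_injP[f fI] KA] [/card_le_injP[g gI] KB].
have [pr prI] := infinite_pairing eI.
split.
  apply/card_le_injP.
  pose h (x : T) : K :=
    match pselect (A x) with
    | left Ax => pr (e 0%N) (val (f (exist _ x (mem_set Ax))))
    | right _ => match pselect (B x) with
                 | left Bx => pr (e 1%N) (val (g (exist _ x (mem_set Bx))))
                 | right _ => e 0%N
                 end
    end.
  exists (fun x => exist _ (h (val x)) (mem_set I)) => -[x xAB] [y yAB] [].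
  have := set_mem xAB; have := set_mem yAB; rewrite /h /= => yAB' xAB' E.
  apply: sval_inj => /=; move: E.
  case: (pselect (A x)) => Ax; case: (pselect (A y)) => Ay.
  - by move=> /prI[_ /val_inj/fI[]].
  - case: (pselect (B y)) => By; first by move=> /prI[/eI].
    by case: yAB'.
  - case: (pselect (B x)) => Bx; first by move=> /prI[/eI].
    by case: xAB'.
  - case: (pselect (B x)) => Bx; last by case: xAB'.
    case: (pselect (B y)) => By; last by case: yAB'.
    by move=> /prI[_ /val_inj/gI[]].
move=> /card_le_injP[h hI].
pose k0 x : [set: K] := exist _ x (mem_set I).
have k0I x y : k0 x = k0 y -> x = y by move=> [].
have [[k kP]|nA] := pselect (exists k, forall l, A (val (h (k0 (pr k l))))).
  apply: KA; apply/card_le_injP.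
  exists (fun l : [set: K] => exist _ (val (h (k0 (pr k (val l))))) (mem_set (kP _))).
  move=> [x x1] [y y1] [] /val_inj/hI/k0I/prI[_ /= xy].
  by apply: sval_inj.
have /choice[l lP] : forall k, exists l, B (val (h (k0 (pr k l)))).
  move=> k; apply: contrapT => nB; apply: nA; exists k => l.
  have [//|Bl] := set_mem (valP (h (k0 (pr k l)))).
  by case: nB; exists l.
apply: KB; apply/card_le_injP.
exists (fun k : [set: K] => exist _ (val (h (k0 (pr (val k) (l (val k)))))) (mem_set (lP _))).
move=> [x x1] [y y1] [] /val_inj/hI/k0I/prI[/= xy _].
by apply: sval_inj.
Qed.

(** * Counting formulas by an injective coding *)

Section CountFormulas.
Variables (L : signature) (T : Type) (cf : fsym L -> T) (cr : rsym L -> T)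
  (cn : nat -> T) (pr : T -> T -> T).
Hypotheses (cfI : injective cf) (crI : injective cr) (cnI : injective cn).
Hypothesis prI : forall x y x' y', pr x y = pr x' y' -> x = x' /\ y = y'.

Fixpoint code_seq (s : seq T) : T :=
  if s is x :: s' then pr (cn 1%N) (pr x (code_seq s')) else pr (cn 0%N) (cn 0%N).

Lemma code_seq_inj : injective code_seq.
Proof.
elim=> [|x s IH] [|y t] //= /prI[].
- by move=> /cnI.
- by move=> /cnI.
- by move=> _ /prI[-> /IH ->].
Qed.

Arguments code_seq : simpl never.

Fixpoint code_term V (rho : V -> T) (t : term L V) : T :=
  match t with
  | Var v => code_seq [:: cn 0%N; rho v]
  | App f ts => code_seq [:: cn 1%N, cf f & map (fun i => code_term rho (ts i)) (enum 'I_(farity f))]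
  end.

Lemma map_enum_inj n (f g : 'I_n -> T) : map f (enum 'I_n) = map g (enum 'I_n) -> f =1 g.
Proof. by move/eq_in_map => H i; apply: H; rewrite mem_enum. Qed.

Lemma code_term_inj V (rho : V -> T) : injective rho -> injective (code_term rho).
Proof.
move=> rhoI; elim=> [v|f ts IH] [w|g us] /= /code_seq_inj[].
- by move=> /rhoI ->.
- by move=> /cnI.
- by move=> /cnI.
- move=> /cfI fg; subst g => /map_enum_inj E; congr App.
  by apply/funext => i; apply: IH; exact: E.
Qed.

Definition code_bound V (rho : V -> T) (o : option V) : T :=
  code_seq (if o is Some v then [:: rho v] else [::]).

Lemma code_bound_inj V (rho : V -> T) : injective rho -> injective (code_bound rho).
Proof. by move=> rhoI [v|] [w|] /code_seq_inj //= -[/rhoI ->]. Qed.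

(** The coding of variables comes last because the type of variables grows under a quantifier;
    [code_bound] then provides a code for the bound variable. *)
Fixpoint code_formula (V : Type) (phi : formula L V) : (V -> T) -> T :=
  match phi with
  | Bot => fun rho => code_seq [:: cn 0%N]
  | Eq t u => fun rho => code_seq [:: cn 1%N; code_term rho t; code_term rho u]
  | Rel r ts => fun rho => code_seq
      [:: cn 2%N, cr r & map (fun i => code_term rho (ts i)) (enum 'I_(rarity r))]
  | Imp a b => fun rho => code_seq [:: cn 3%N; code_formula a rho; code_formula b rho]
  | All a => fun rho => code_seq [:: cn 4%N; code_formula a (code_bound rho)]
  end.

Lemma code_formula_inj (V : Type) (phi : formula L V) (rho : V -> T) (psi : formula L V) :
  injective rho -> code_formula phi rho = code_formula psi rho -> phi = psi.
Proof.
elim: phi rho psi => {V} [V|V t u|V r ts|V a IHa b IHb|V a IH] rho.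
- by case=> [|t' u'|r' ts'|a' b'|a'] _ //= /code_seq_inj[] /cnI.
- case=> [|t' u'|r' ts'|a' b'|a'] rhoI /= /code_seq_inj[]; try by move/cnI.
  by move=> /(code_term_inj rhoI) -> /(code_term_inj rhoI) ->.
- case=> [|t' u'|r' ts'|a' b'|a'] rhoI /= /code_seq_inj[]; try by move/cnI.
  move=> /crI rr'; subst r' => /map_enum_inj E; congr Rel.
  by apply/funext => i; apply: (code_term_inj rhoI); exact: E.
- case=> [|t' u'|r' ts'|a' b'|a'] rhoI /= /code_seq_inj[]; try by move/cnI.
  by move=> /(IHa _ _ rhoI) -> /(IHb _ _ rhoI) ->.
- case=> [|t' u'|r' ts'|a' b'|a'] rhoI /= /code_seq_inj[]; try by move/cnI.
  by move=> /(IH _ _ (code_bound_inj rhoI)) ->.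
Qed.

End CountFormulas.

(** * Saturation for tuples *)

Lemma finite_set_seq T (F : set T) : finite_set F ->
  exists s : seq T, forall x, F x <-> List.In x s.
Proof.
move=> /(@finite_seqP {classic T})[s ->]; exists s => x /=.
elim: s => [|y s IH] //=; rewrite in_cons; split.
  by move=> /orP[/eqP ->|/IH]; [left|right].
by move=> [->|/IH ->]; rewrite ?eqxx ?orbT.
Qed.

Definition from_I0 (T : Type) (i : 'I_0) : T := match notF (ltn_ord i) with end.

Section FormulaBuilding.
Variable L : signature.

Definition And V (a b : formula L V) : formula L V := Neg (Imp a (Neg b)).

Lemma sat_And (N : structure L) V (v : V -> N) (a b : formula L V) :
  sat v (And a b) <-> sat v a /\ sat v b.
Proof.
split=> /= [ab|[sa sb] /(_ sa) //].
by split; apply: contrapT => H; apply: ab => // sa sb; case: H.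
Qed.

Definition Ands V (s : seq (formula L V)) : formula L V :=
  foldr (@And V) (Neg (Bot L V)) s.

Lemma sat_Ands (N : structure L) V (v : V -> N) (s : seq (formula L V)) :
  sat v (Ands s) <-> forall phi, List.In phi s -> sat v phi.
Proof.
elim: s => [|a s IH]; first by split=> // _ /=.
rewrite [Ands _]/= sat_And IH; split=> [[sa H] phi [<-//|/H]//|H].
by split=> [|phi ?]; apply: H; [left|right].
Qed.

Definition tcons (N : Type) n (x : N) (y : 'I_n -> N) (i : 'I_n.+1) : N :=
  if unlift ord0 i is Some j then y j else x.

Lemma tcons_eta (N : Type) n (x : 'I_n.+1 -> N) :
  tcons (x ord0) (fun i => x (lift ord0 i)) = x.
Proof. by apply/funext => i; rewrite /tcons; case: unliftP => [j|] ->. Qed.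

(** One formula has to serve all structures, since the transfer between M and [Mstar] evaluates it
    in both. *)
Lemma ex_All (n : nat) (U : Type) (phi : formula L ('I_n + U)) :
  exists psi : formula L U, forall (N : structure L) (u : U -> N),
    sat u psi <-> forall x : 'I_n -> N, sat (env x u) phi.
Proof.
elim: n U phi => [|n IH] U phi.
  pose f (i : 'I_0 + U) : U := match i with inl i => from_I0 _ i
    | inr u => u end.
  exists (frename f phi) => N u; rewrite sat_rename.
  have E (x : 'I_0 -> N) : u \o f = env x u by apply/funext => -[[]|].
  by split=> [H x|H]; [rewrite -E|rewrite (E (@from_I0 _))].
pose f (i : 'I_n.+1 + U) : option ('I_n + U) :=
  match i with inl i => omap inl (unlift ord0 i) | inr u => Some (inr u) end.
have [psi psiP] := IH U (All (frename f phi)).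
exists psi => N u; rewrite psiP.
have E (x : N) (y : 'I_n -> N) : scons x (env y u) \o f = env (tcons x y) u.
  by apply/funext => -[i|//] /=; rewrite /tcons; case: unliftP.
split=> [H x|H y /= x].
  by have /= /(_ (x ord0)) := H (fun i => x (lift ord0 i)); rewrite sat_rename E tcons_eta.
by rewrite sat_rename E.
Qed.

End FormulaBuilding.

Section Saturation.
Variables (K : Type) (L : signature) (N : structure L) (e : nat -> K).
Hypotheses (eI : injective e) (satN : saturated K N).

Lemma card_lt_finite T (A : set T) : finite_set A -> card_lt A [set: K].
Proof.
move=> Afin; have natK : [set: nat] #<= [set: K] by exact: card_leT_inj eI.
split; first exact: card_le_trans (finite_set_countable Afin) natK.
by move=> KA; apply: infinite_nat; apply: card_le_finite Afin; exact: card_le_trans KA.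
Qed.

(** Induction on the number of variables, [saturated] being about one variable. Once the first
    coordinate is realized by [a], it joins the parameters, which remain fewer than [K]. *)
Lemma saturated_tuple n (A : set N) (p : set (formula L ('I_n + A))) :
  card_lt A [set: K] ->
  (forall s, (forall phi, List.In phi s -> p phi) ->
     exists x : 'I_n -> N, forall phi, List.In phi s -> sat (env x val) phi) ->
  exists x : 'I_n -> N, forall phi, p phi -> sat (env x val) phi.
Proof.
elim: n A p => [|n IH] A p sA fs.
  exists (@from_I0 _) => phi pphi.
  have [|x /(_ phi) H] := fs [:: phi]; first by move=> _ [<-|//].
  suff -> : (@from_I0 _) = x by apply: H; left.
  by apply/funext => -[].
pose f (i : 'I_n.+1 + A) : 'I_n + option A :=
  match i with
  | inl i => if unlift ord0 i is Some j then inl j else inr None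
  | inr a => inr (Some a)
  end.
have E (x : N) (y : 'I_n -> N) : env y (scons x val) \o f = env (tcons x y) val.
  by apply/funext => -[i|//] /=; rewrite /tcons; case: unliftP.
(* The type of the first coordinate: formulas asserting that the other coordinates exist for some
   finite part of [p]. *)
pose p1 := [set psi : formula L (option A) | exists s,
  (forall phi, List.In phi s -> p phi) /\
  forall v, sat v psi <-> exists y : 'I_n -> N, sat (env y v) (frename f (Ands s))].
have ex_p1 s : (forall phi, List.In phi s -> p phi) -> exists psi, p1 psi /\
    forall v, sat v psi <-> exists y : 'I_n -> N, sat (env y v) (frename f (Ands s)).
  move=> sp; have [psi psiP] := ex_All (Neg (frename f (Ands s))).
  have H v : sat v (Neg psi) <-> exists y : 'I_n -> N, sat (env y v) (frename f (Ands s)).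
    split=> [/= nH|[y Hy] /= /psiP /(_ y) /= H]; last exact: H.
    by apply: contrapT => nE; apply: nH; apply/psiP => y Hy; apply: nE; exists y.
  by exists (Neg psi); split; [exists s|exact: H].
have [|a aP] := satN sA (p := p1).
  move=> F Fp1 /finite_set_seq[fs1 fs1P].
  have [s [sp sP]] : exists s, (forall phi, List.In phi s -> p phi) /\
      forall v psi, List.In psi fs1 ->
        (exists y : 'I_n -> N, sat (env y v) (frename f (Ands s))) -> sat v psi.
    have : forall psi, List.In psi fs1 -> p1 psi by move=> psi /fs1P/Fp1.
    elim: fs1 {fs1P} => [|psi fs1 IHs] Hp1; first by exists [::].
    have [|s [sp sP]] := IHs; first by move=> ? ?; apply: Hp1; right.
    have [t [tp tP]] := Hp1 psi (or_introl erefl).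
    exists (t ++ s); split.
      by move=> phi /(@List.in_app_or _ t s)[/tp|/sp].
    have C v : (exists y : 'I_n -> N, sat (env y v) (frename f (Ands (t ++ s)))) ->
      (exists y : 'I_n -> N, sat (env y v) (frename f (Ands t))) /\
      (exists y : 'I_n -> N, sat (env y v) (frename f (Ands s))).
      move=> [y /sat_rename/sat_Ands H]; split; exists y; apply/sat_rename/sat_Ands => phi i;
        apply: H; apply/(@List.in_or_app _ t s); tauto.
    move=> v ? [<-|i] /C[Ct Cs]; first exact/tP.
    exact: sP.
  have [x xP] := fs s sp.
  exists (x ord0) => psi /fs1P /sP; apply; exists (fun i => x (lift ord0 i)).
  by rewrite sat_rename E tcons_eta; apply/sat_Ands.
pose A' := A `|` [set a].
have sA' : card_lt A' [set: K].
  by apply: (card_lt_setU eI) => //; apply: card_lt_finite.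
have Aa' : a \in A' by apply: mem_set; right.
have AA' b : b \in A -> b \in A' by move=> /set_mem ?; apply: mem_set; left.
pose j (o : option A) : A' :=
  if o is Some b then exist _ (val b) (AA' _ (valP b)) else exist _ a Aa'.
pose g (i : 'I_n + option A) : 'I_n + A' :=
  match i with inl i => inl i | inr o => inr (j o) end.
have E' (y : 'I_n -> N) : env y val \o g = env y (scons a val).
  by apply/funext => -[|[]].
have [|y yP] := IH A' [set psi | exists2 phi, p phi & psi = frename g (frename f phi)] sA'.
  move=> s sp.
  have [t [tp tP]] : exists t, (forall phi, List.In phi t -> p phi) /\
      forall psi, List.In psi s -> exists2 phi, List.In phi t & psi = frename g (frename f phi).
    elim: s sp => [|psi s IHs] sp; first by exists [::].
    have [|t [tp tP]] := IHs; first by move=> ? ?; apply: sp; right.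
    have [phi pphi psiE] := sp psi (or_introl erefl).
    exists (phi :: t); split; first by move=> ? [<-|/tp].
    move=> ? [<-|/tP[phi' ? ?]]; first by exists phi => //; left.
    by exists phi' => //; right.
  have [psi [p1psi psiP]] := ex_p1 t tp.
  have /psiP[y /sat_rename/sat_Ands H] := aP psi p1psi.
  exists y => _ /tP[phi it ->].
  by rewrite !sat_rename E'; exact: H.
exists (tcons a y) => phi pphi.
have := yP (frename g (frename f phi)); rewrite !sat_rename E' E; apply.
by exists phi.
Qed.

End Saturation.

(** * Relations definable over M *)

Section Definability.
Variables (L : signature) (S : defGroup L).
Local Notation G := (GM S).
Local Notation G' := (GMstar S).
Local Notation n := (dim S).

(* A variable in [V] stands for an element of G(Mstar), hence for the [dim S]
   first-order variables that give its coordinates. *)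
Definition interp V (v : V -> G') : V * 'I_n + M S -> Mstar S :=
  env (fun x => coord (v x.1) x.2) (@emb L S).

Definition definable V (P : (V -> G') -> Prop) : Prop :=
  exists phi : formula L (V * 'I_n + M S), forall v, sat (interp v) phi <-> P v.

Lemma sat_domF (x : 'I_n -> Mstar S) : sat x (domF S) <-> exists a : G', coord a = x.
Proof.
have [_ cG _] := GMstar_definable S.
change (sat x (domF S)) with ([set x | sat x (domF S)] x); rewrite -cG; split.
  by move=> [a _ <-]; exists a.
by move=> [a <-]; exists a.
Qed.

Lemma coord_inj : injective (@coord L S).
Proof. by have [] := GMstar_definable S. Qed.

Lemma emb_sat V (phi : formula L V) (v : V -> M S) :
  sat v phi <-> sat (@emb L S \o v) phi.
Proof. exact: (emb_elementary phi v). Qed.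

Lemma coord_incl (g : G) : coord (incl g) = @emb L S \o coordM g.
Proof.
have : exists a : G', coord a = @emb L S \o coordM g.
  apply/sat_domF/emb_sat.
  have [_ cG _] := GM_definable S.
  by change ([set x | sat x (domF S)] (coordM g)); rewrite -cG; exists g.
exact: (@xgetPex _ 1 [set a : G' | coord a = @emb L S \o coordM g]).
Qed.

Lemma incl_onto (a : G') (x : 'I_n -> M S) :
  coord a = @emb L S \o x -> exists g : G, incl g = a.
Proof.
move=> ax; have [_ cG _] := GM_definable S.
have : [set x | sat x (domF S)] x.
  by apply/emb_sat; apply/sat_domF; exists a.
by rewrite -cG => -[g _ gx]; exists g; apply: coord_inj; rewrite coord_incl gx ax.
Qed.

Lemma inclM (a b : G) : incl (a * b) = incl a * incl b :> G'.
Proof.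
have [_ _ mulE] := GM_definable S; have [_ _ mulE'] := GMstar_definable S.
have /mulE/emb_sat : a * b = a * b by [].
suff -> : @emb L S \o env (env (coordM a) (coordM b)) (coordM (a * b)) =
  env (env (coord (incl a)) (coord (incl b))) (coord (incl (a * b))) by move/mulE'.
by rewrite !coord_incl; apply/funext => -[[i|i]|i].
Qed.

Lemma incl1 : incl (1 : G) = 1 :> G'.
Proof. by have := inclM 1 1; rewrite mulg1 => /(congr1 (fun x => (incl 1)^-1 * x)); rewrite mulKg mulVg. Qed.

Lemma inclV (a : G) : incl a^-1 = (incl a)^-1 :> G'.
Proof. by apply: (mulgI (incl a)); rewrite -inclM !mulgV incl1. Qed.

Lemma definable_iff V (P Q : (V -> G') -> Prop) :
  (forall v, P v <-> Q v) -> definable P -> definable Q.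
Proof. by move=> PQ [phi H]; exists phi => v; rewrite H. Qed.

Lemma definable_False V : definable (fun _ : V -> G' => False).
Proof. by exists (Bot _ _). Qed.

Lemma definable_imp V (P Q : (V -> G') -> Prop) :
  definable P -> definable Q -> definable (fun v => P v -> Q v).
Proof. by move=> [a aP] [b bP]; exists (Imp a b) => v /=; rewrite aP bP. Qed.

Lemma definable_True V : definable (fun _ : V -> G' => True).
Proof. by apply: definable_iff (definable_imp (@definable_False V) (@definable_False V)). Qed.

Lemma definable_cst V (b : Prop) : definable (fun _ : V -> G' => b).
Proof.
have [Hb|nb] := pselect b; first exact: definable_iff (@definable_True V).
exact: definable_iff (@definable_False V).
Qed.

Lemma definable_not V (P : (V -> G') -> Prop) :
  definable P -> definable (fun v => ~ P v).
Proof. by move=> dP; exact: definable_imp dP (@definable_False V). Qed.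

Lemma definable_and V (P Q : (V -> G') -> Prop) :
  definable P -> definable Q -> definable (fun v => P v /\ Q v).
Proof. by move=> [a aP] [b bP]; exists (And a b) => v; rewrite sat_And aP bP. Qed.

Lemma definable_or V (P Q : (V -> G') -> Prop) :
  definable P -> definable Q -> definable (fun v => P v \/ Q v).
Proof.
move=> dP dQ; have := definable_imp (definable_not dP) dQ.
apply: definable_iff => v; split; last by case.
by move=> H; have [|/H] := pselect (P v); [left|right].
Qed.

Lemma definable_rename V W (f : V -> W) (P : (V -> G') -> Prop) :
  definable P -> definable (fun w : W -> G' => P (fun i => w (f i))).
Proof.
move=> [phi phiP].
exists (frename (fun x => match x with inl (i, k) => inl (f i, k) | inr m => inr m end) phi) => w.
rewrite sat_rename -phiP; suff -> : interp (fun i => w (f i)) = interp w \o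
  (fun x => match x with inl (i, k) => inl (f i, k) | inr m => inr m end) by [].
by apply/funext => -[[i k]|m].
Qed.

Lemma definable_all V (Q : G' -> (V -> G') -> Prop) :
  definable (fun w : option V -> G' => Q (w None) (fun i => w (Some i))) ->
  definable (fun v : V -> G' => forall x, Q x v).
Proof.
move=> [phi phiP].
pose f (x : option V * 'I_n + M S) : 'I_n + (V * 'I_n + M S) :=
  match x with
  | inl (None, k) => inl k
  | inl (Some i, k) => inr (inl (i, k))
  | inr m => inr (inr m)
  end.
have [psi psiP] := ex_All (Imp (frename inl (domF S)) (frename f phi)).
have E v x : env (coord x) (interp v) \o f = interp (scons x v).
  by apply/funext => -[[[i|] k]|m].
exists psi => v; rewrite psiP; split=> [H x|H y /=].
  have /= := H (coord x); rewrite !sat_rename E phiP /=; apply.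
  by apply/sat_domF; exists x.
rewrite !sat_rename => /sat_domF[a ay].
by have -> : y = coord a by []; rewrite E phiP; exact: H.
Qed.

Lemma definable_ex V (Q : G' -> (V -> G') -> Prop) :
  definable (fun w : option V -> G' => Q (w None) (fun i => w (Some i))) ->
  definable (fun v : V -> G' => exists x, Q x v).
Proof.
move=> dQ.
have := definable_not (@definable_all _ (fun x v => ~ Q x v) (definable_not dQ)).
apply: definable_iff => v; split=> [H|[x Qx] /(_ x)//].
by apply: contrapT => nE; apply: H => x Qx; apply: nE; exists x.
Qed.

Lemma definable_param V (g : G) (P : (option V -> G') -> Prop) :
  definable P -> definable (fun v : V -> G' => P (scons (incl g) v)).
Proof.
move=> [phi phiP].
pose f (x : option V * 'I_n + M S) : V * 'I_n + M S :=
  match x with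
  | inl (None, k) => inr (coordM g k)
  | inl (Some i, k) => inl (i, k)
  | inr m => inr m
  end.
exists (frename f phi) => v; rewrite sat_rename -phiP.
suff -> : interp (scons (incl g) v) = interp v \o f by [].
by apply/funext => -[[[i|] k]|m] //=; rewrite coord_incl.
Qed.

Lemma definable_mul V (a b c : V) : definable (fun v : V -> G' => v a * v b = v c).
Proof.
have [_ _ mulE'] := GMstar_definable S.
exists (frename (fun x => match x with
  | inl (inl i) => inl (a, i) | inl (inr i) => inl (b, i) | inr i => inl (c, i) end) (mulF S)) => v.
rewrite -mulE' sat_rename.
set w1 := _ \o _; set w2 := env _ _; suff -> : w1 = w2 by [].
by apply/funext => -[[i|i]|i].
Qed.

Lemma definable_eq V (a b : V) : definable (fun v : V -> G' => v a = v b).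
Proof.
have := definable_param 1 (definable_mul (Some a) None (Some b)).
by apply: definable_iff => v /=; rewrite incl1 mulg1.
Qed.

(** Multiplication of the group is only a formula of [L], so a term of the group language is handled
    through its graph. *)
Definition dterm V (t : (V -> G') -> G') : Prop :=
  definable (fun w : option V -> G' => t (fun i => w (Some i)) = w None).

Lemma dterm_var V (a : V) : dterm (fun v => v a).
Proof. exact: definable_eq. Qed.

Lemma dterm_const V (g : G) : dterm (fun _ : V -> G' => incl g).
Proof.
have := definable_param g (definable_eq (None : option (option V)) (Some None)).
exact: definable_iff.
Qed.

Lemma dterm_one V : dterm (fun _ : V -> G' => 1).
Proof. by rewrite -incl1; exact: dterm_const. Qed.

Lemma dterm_rename V W (f : V -> W) (t : (V -> G') -> G') :
  dterm t -> dterm (fun w => t (fun i => w (f i))).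
Proof. by move=> /(definable_rename (omap f)). Qed.

Lemma definable_subst V (P : (option V -> G') -> Prop) (t : (V -> G') -> G') :
  definable P -> dterm t -> definable (fun v => P (scons (t v) v)).
Proof.
move=> dP dt.
apply: (definable_iff (P := fun v => exists x, t v = x /\ P (scons x v))).
  by move=> v; split=> [[x [<-]]//|Pt]; exists (t v).
apply: (@definable_ex _ (fun x v => t v = x /\ P (scons x v))).
apply: definable_and; first exact: dt.
have := definable_rename (fun o : option V => o) dP.
apply: definable_iff => w; suff -> : w = scons (w None) (fun i => w (Some i)) by [].
by apply/funext => -[].
Qed.

Lemma definable_eqt V (t s : (V -> G') -> G') :
  dterm t -> dterm s -> definable (fun v => t v = s v).
Proof. by move=> dt ds; apply: definable_iff (definable_subst dt ds) => v. Qed.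

Lemma dterm_mul V (t s : (V -> G') -> G') :
  dterm t -> dterm s -> dterm (fun v => t v * s v).
Proof.
move=> dt ds; rewrite /dterm.
have d1 := definable_mul (Some None : option (option (option V))) None (Some (Some None)).
have d2 := definable_subst d1 (dterm_rename (fun i => Some (Some i)) ds).
by have := definable_subst d2 (dterm_rename Some dt); apply: definable_iff => v.
Qed.

Lemma dterm_inv V (t : (V -> G') -> G') : dterm t -> dterm (fun v => (t v)^-1).
Proof.
move=> dt; rewrite /dterm.
have := definable_eqt (dterm_mul (dterm_rename Some dt) (dterm_var None)) (@dterm_one (option V)).
by apply: definable_iff => v; split=> [/mulg1_eq//|<-]; rewrite mulgV.
Qed.

End Definability.

Section DefinableSets.
Variables (L : signature) (S : defGroup L).
Local Notation G := (GM S).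
Local Notation G' := (GMstar S).
Local Notation n := (dim S).

Definition dset (A : set G') : Prop := definable (fun v : unit -> G' => A (v tt)).

Lemma definable_mem (A : set G') V (t : (V -> G') -> G') :
  dset A -> dterm t -> definable (fun v => A (t v)).
Proof.
move=> dA dt.
exact: (definable_subst (definable_rename (fun=> None : option V) dA) dt).
Qed.

Lemma dset_defMstar (phi : Mformula S) : dset (defMstar phi).
Proof.
exists (frename (fun x => match x with inl i => inl (tt, i) | inr m => inr m end) phi) => v.
rewrite sat_rename /defMstar /=; set w1 := _ \o _; set w2 := env _ _.
suff -> : w1 = w2 by [].
by apply/funext => -[].
Qed.

Lemma dsetP (A : set G') : dset A -> exists phi : Mformula S, A = defMstar phi.
Proof.
move=> [phi phiP].
exists (frename (fun x => match x with inl i => inl i.2 | inr m => inr m end) phi).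
apply/seteqP; split=> a; rewrite /defMstar /= sat_rename -(phiP (fun=> a));
  set w1 := interp _; set w2 := _ \o _; suff -> : w1 = w2 by [].
all: by apply/funext => -[[[] i]|].
Qed.

Lemma dset_setC (A : set G') : dset A -> dset (~` A).
Proof. exact: definable_not. Qed.

Lemma defM_incl (phi : Mformula S) g : defM phi g <-> defMstar phi (incl g).
Proof.
rewrite /defM /defMstar /= emb_sat coord_incl; set w1 := _ \o _; set w2 := env _ _.
suff -> : w1 = w2 by [].
by apply/funext => -[].
Qed.

End DefinableSets.

(** * Tactics deriving definability from the shape of a relation *)

Ltac dterm_tac :=
  lazymatch goal with
  | |- dterm (fun v => v ?a) => apply dterm_var
  | |- dterm (fun v => 1) => apply dterm_one
  | |- dterm (fun v => incl ?g) => apply dterm_const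
  | |- dterm (fun v => @?t v * @?s v) => apply (@dterm_mul _ _ _ t s); dterm_tac
  | |- dterm (fun v => (@?t v)^-1) => apply (@dterm_inv _ _ _ t); dterm_tac
  end.

Ltac defi :=
  cbv beta;
  lazymatch goal with
  | |- definable (fun _ => True) => apply definable_True
  | |- definable (fun _ => False) => apply definable_False
  | |- definable (fun v => @?P v /\ @?Q v) => apply (@definable_and _ _ _ P Q); defi
  | |- definable (fun v => @?P v \/ @?Q v) => apply (@definable_or _ _ _ P Q); defi
  | |- definable (fun v => ~ @?P v) => apply (@definable_not _ _ _ P); defi
  | |- definable (fun v => @?P v -> @?Q v) => apply (@definable_imp _ _ _ P Q); defi
  | |- definable (fun v => exists x, @?Q v x) =>
      apply (@definable_ex _ _ _ (fun x v => Q v x)); defi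
  | |- definable (fun v => forall x, @?Q v x) =>
      apply (@definable_all _ _ _ (fun x v => Q v x)); defi
  | |- definable (fun v => @?t v = @?s v) => apply (@definable_eqt _ _ _ t s); dterm_tac
  | |- definable (fun v => ?A (@?t v)) =>
      apply (@definable_mem _ _ A _ t); [by auto | dterm_tac]
  | |- _ => idtac
  end.

(** * Transfer between G(Mstar) and G(M) *)

Section Transfer.
Variables (L : signature) (S : defGroup L).
Local Notation G := (GM S).
Local Notation G' := (GMstar S).
Local Notation n := (dim S).
Implicit Types A B : set G'.

Lemma definable_ex_tuple (N : nat) V (Q : ('I_N -> G') -> (V -> G') -> Prop) :
  definable (fun w : 'I_N + V -> G' => Q (fun i => w (inl i)) (fun i => w (inr i))) ->
  definable (fun v : V -> G' => exists x, Q x v).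
Proof.
elim: N V Q => [|N IH] V Q dQ.
  have := definable_rename (fun x : 'I_0 + V => match x with inl i => from_I0 _ i | inr u => u end) dQ.
  apply: definable_iff => v; split=> [H|[x]]; first by exists (fun i => v (from_I0 _ i)).
  by have -> : x = (fun i => v (from_I0 _ i)) by apply/funext => -[].
apply: (definable_iff (P := fun v => exists x0, exists x : 'I_N -> G', Q (tcons x0 x) v)).
  move=> v; split=> [[x0 [x Qx]]|[x Qx]]; first by exists (tcons x0 x).
  by exists (x ord0), (fun i => x (lift ord0 i)); rewrite tcons_eta.
apply: (@definable_ex _ _ _ (fun x0 v => exists x : 'I_N -> G', Q (tcons x0 x) v)).
apply: (IH _ (fun x (w : option V -> G') => Q (tcons (w None) x) (fun i => w (Some i)))).
have := definable_rename (fun x : 'I_N.+1 + V => match x with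
  | inl i => if unlift ord0 i is Some j then inl j else inr None
  | inr u => inr (Some u) end) dQ.
apply: definable_iff => w.
set x1 := fun i => _; set x2 := tcons _ _; suff -> : x1 = x2 by [].
by apply/funext => i; rewrite /x1 /x2 /tcons; case: unliftP.
Qed.

Lemma definable_all_tuple (N : nat) V (Q : ('I_N -> G') -> (V -> G') -> Prop) :
  definable (fun w : 'I_N + V -> G' => Q (fun i => w (inl i)) (fun i => w (inr i))) ->
  definable (fun v : V -> G' => forall x, Q x v).
Proof.
move=> dQ.
have := definable_not (@definable_ex_tuple N V (fun x v => ~ Q x v) (definable_not dQ)).
apply: definable_iff => v; split=> [H x|H [x]]; last by apply; exact: H.
by apply: contrapT => nQ; apply: H; exists x.
Qed.

(** Elementarity is applied to the sentence over M saying that no tuple of the group satisfies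
    [phi]: it fails in [Mstar], hence in M, where a counterexample is an element of G(M). *)
Lemma transfer1 A : dset A -> (exists x, A x) -> exists g : G, A (incl g).
Proof.
move=> /dsetP[phi ->] [a pa].
have [psi psiP] := ex_All (Neg (And phi (frename inl (domF S)))).
have D (N : structure L) (x : 'I_n -> N) (m : M S -> N) :
    sat (env x m) (frename inl (domF S)) <-> sat x (domF S).
  by rewrite sat_rename.
have : ~ sat (@emb L S) psi.
  move=> /psiP /(_ (coord a)); apply; apply/sat_And; split; first exact: pa.
  by apply/D/sat_domF; exists a.
move=> npsi; have : ~ sat id psi by move=> /emb_sat.
move=> /psiP/existsNP[x /= /contrapT /sat_And[px /D dx]].
have /sat_domF[b bx] : sat (@emb L S \o x) (domF S) by apply/emb_sat.
have [g gb] := incl_onto bx; exists g; rewrite gb /defMstar /= bx.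
move: px => /emb_sat; set w1 := _ \o _; set w2 := env _ _; suff -> : w1 = w2 by [].
by apply/funext => -[].
Qed.

Lemma transfer_tuple (N : nat) (P : ('I_N -> G') -> Prop) :
  definable P -> (exists v, P v) -> exists v : 'I_N -> G, P (fun i => incl (v i)).
Proof.
elim: N P => [|N IH] P dP [v Pv].
  exists (fun=> 1); suff -> : (fun i : 'I_0 => incl 1) = v by [].
  by apply/funext => -[].
have dQ : definable (fun w : option 'I_N -> G' => P (tcons (w None) (fun i => w (Some i)))).
  have := definable_rename (fun i : 'I_N.+1 => unlift ord0 i) dP.
  apply: definable_iff => w; set x1 := fun i => _; set x2 := tcons _ _.
  suff -> : x1 = x2 by [].
  by apply/funext => i; rewrite /x1 /x2 /tcons; case: unliftP.
have [||g [x Px]] := @transfer1 [set x0 | exists x : 'I_N -> G', P (tcons x0 x)].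
- apply: (@definable_ex_tuple N unit (fun x v => P (tcons (v tt) x))).
  have := definable_rename (fun o : option 'I_N => if o is Some i then inl i else inr tt) dQ.
  exact: definable_iff.
- by exists (v ord0), (fun i => v (lift ord0 i)); rewrite tcons_eta.
have [|y Py] := IH (fun y => P (tcons (incl g) y)) _ (ex_intro _ x Px).
  exact: definable_param dQ.
exists (tcons g y); set y' := fun i => _; suff -> : y' = tcons (incl g) (fun i => incl (y i)) by [].
by apply/funext => i; rewrite /y' /tcons; case: unliftP.
Qed.

Lemma transfer_all_tuple (N : nat) (P : ('I_N -> G') -> Prop) :
  definable P -> (forall v : 'I_N -> G, P (fun i => incl (v i))) -> forall v, P v.
Proof.
move=> dP H v; apply: contrapT => nP.
have [|w] := transfer_tuple (definable_not dP); first by exists v.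
by apply.
Qed.

Lemma transfer_sub A B : dset A -> dset B ->
  (forall g : G, A (incl g) -> B (incl g)) -> A `<=` B.
Proof.
move=> dA dB AB x Ax; apply: contrapT => nB.
have [||g [Ag]] := @transfer1 [set x | A x /\ ~ B x].
- by rewrite /dset /=; defi.
- by exists x.
- by apply; exact: AB.
Qed.

Lemma dset_mulset A B : dset A -> dset B -> dset (mulset A B).
Proof.
move=> dA dB.
apply: (definable_iff (P := fun v : unit -> G' => exists x y, [/\ A x & B y] /\ x * y = v tt)).
  move=> v; split=> [[x [y [[Ax By] <-]]]|[x Ax [y By <-]]]; first by exists x => //; exists y.
  by exists x, y.
apply: (definable_iff (P := fun v : unit -> G' => exists x y, (A x /\ B y) /\ x * y = v tt)).
  by move=> v; split=> -[x [y [[Ax By] <-]]]; exists x, y.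
by defi.
Qed.

End Transfer.

(** * Types and coheirs in the monster model *)

Section Monster.
Variables (K : Type) (L : signature) (S : defGroup L).
Hypothesis hK : monster K S.
Local Notation G := (GM S).
Local Notation G' := (GMstar S).
Local Notation n := (dim S).
Local Notation Lam := (fsym L + rsym L + M S + nat)%type.
Implicit Types A B D : set G'.

Lemma card_lt_Lam T (A : set T) : A #<= [set: set Lam] -> card_lt A [set: K].
Proof. by case: hK => hc _ _ /card_lt_le; apply. Qed.

Lemma nat_inj_K : exists e : nat -> K, injective e.
Proof.
have [[/inj_card_leT[f fI] _] _ _] := hK.
exists (fun k => f [set inr k]) => k l /fI kl.
by have [] : [set inr l] (inr k : Lam) by rewrite -kl.
Qed.

Lemma card_lt_finite_K T (A : set T) : finite_set A -> card_lt A [set: K].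
Proof. by have [e eI] := nat_inj_K; exact: (@card_lt_finite _ _ eI). Qed.

Lemma card_lt_setU_K T (A B : set T) :
  card_lt A [set: K] -> card_lt B [set: K] -> card_lt (A `|` B) [set: K].
Proof. by have [e eI] := nat_inj_K; exact: (@card_lt_setU _ _ _ _ _ eI). Qed.

Lemma card_lt_fin_bigcup k T (B : 'I_k -> set T) :
  (forall i, card_lt (B i) [set: K]) ->
  card_lt [set y | exists i, B i y] [set: K].
Proof.
elim: k B => [|k IH] B sB.
  by apply: card_lt_finite_K; rewrite (_ : mkset _ = set0) //; apply/seteqP; split=> y // [[]].
apply: (card_lt_le (B := B ord0 `|` [set y | exists i, B (lift ord0 i) y])).
  apply: subset_card_le => y [i]; case: (unliftP ord0 i) => [j|] -> Biy; last by left.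
  by right; exists j.
by apply: card_lt_setU_K => //; apply: IH.
Qed.

Lemma card_lt_emb : card_lt (range (@emb L S)) [set: K].
Proof.
apply: card_lt_Lam; apply: card_le_trans (card_image_le _ _) _.
apply: (@card_leT_inj _ _ (fun m => [set inl (inr m)])) => x y xy.
by have [] : [set inl (inr y)] (inl (inr x) : Lam) by rewrite -xy.
Qed.

(** Formulas over M are coded by elements of [Lam], hence sets of formulas by subsets of [Lam]; this
    is why [monster] asks kappa to exceed a power set. *)
Lemma card_lt_types : card_lt [set: set (Mformula S)] [set: K].
Proof.
apply: card_lt_Lam.
have [pr prI] := @infinite_pairing Lam inr (fun _ _ H => congr1 (fun x => if x is inr k then k else 0%N) H).
have [f fI] : exists f : Mformula S -> Lam, injective f.
  pose e := infinite_pairing.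
  pose rho (x : 'I_n + M S) : Lam := match x with
    | inl i => inr (nat_of_ord i) | inr m => inl (inr m) end.
  exists (fun phi => code_formula (fun f => inl (inl (inl f))) (fun r => inl (inl (inr r)))
     inr pr phi rho) => phi psi.
  apply: code_formula_inj => //.
  - by move=> x y [].
  - by move=> x y [].
  - by move=> x y [].
  - by move=> [i|m] [j|m'] // []; [move=> /val_inj ->|move=> ->].
apply: (@card_leT_inj _ _ (fun p => f @` p)) => p q pq.
apply/seteqP; split=> phi pphi.
  have : (f @` p) (f phi) by exists phi.
  by rewrite pq => -[psi qpsi /fI <-].
have : (f @` q) (f phi) by exists phi.
by rewrite -pq => -[psi qpsi /fI <-].
Qed.

(** The first-order parameters are M and the coordinates of all [u j], still fewer than kappa. Large
    families [u] occur when a coheir is realized over representatives of all cosets of a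
    subgroup. *)
Lemma saturation J (u : J -> G') (F : set ((option J -> G') -> Prop)) :
  card_lt [set: J] [set: K] -> (forall P, F P -> definable P) ->
  (forall s, (forall P, List.In P s -> F P) ->
     exists x, forall P, List.In P s -> P (scons x u)) ->
  exists x, forall P, F P -> P (scons x u).
Proof.
move=> sJ dF fs; have [_ satK _] := hK; have [e eI] := nat_inj_K.
pose A := range (@emb L S) `|` [set y | exists i, range (fun j => coord (u j) i) y].
have sA : card_lt A [set: K].
  apply: card_lt_setU_K; first exact: card_lt_emb.
  by apply: card_lt_fin_bigcup => i; apply: card_lt_le (card_image_le _ _) sJ.
have Ae m : emb m \in A by apply: mem_set; left; exists m.
have Au j i : coord (u j) i \in A by apply: mem_set; right; exists i, j.
pose r (x : option J * 'I_n + M S) : 'I_n + A := match x with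
  | inl (None, i) => inl i
  | inl (Some j, i) => inr (exist (fun x => x \in A) _ (Au j i))
  | inr m => inr (exist (fun x => x \in A) _ (Ae m)) end.
have E x : env (coord x) val \o r = interp (scons x u).
  by apply/funext => -[[[j|] i]|m].
pose p := [set psi : formula L ('I_n + A) | psi = frename inl (domF S) \/
  exists P phi, [/\ F P, forall v, sat (interp v) phi <-> P v & psi = frename r phi]].
have [|x xP] := saturated_tuple eI satK (p := p) sA.
  move=> s sp.
  have [t [tF tP]] : exists t, (forall P, List.In P t -> F P) /\
      forall psi, List.In psi s -> psi = frename inl (domF S) \/
        exists P phi, [/\ List.In P t, forall v, sat (interp v) phi <-> P v & psi = frename r phi].
    elim: s sp => [|psi s IH] sp; first by exists [::].
    have [|t [tF tP]] := IH; first by move=> ? ?; apply: sp; right.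
    have [psiE|[P [phi [FP phiP psiE]]]] := sp psi (or_introl erefl).
      by exists t; split => // _ [<-|/tP//]; left.
    exists (P :: t); split; first by move=> ? [<-|/tF].
    move=> _ [<-|/tP[->|[Q [phi' [Qt ? ->]]]]]; last 1 first.
    - by right; exists Q, phi'; split => //; right.
    - by right; exists P, phi; split => //; left.
    - by left.
  have [x xP] := fs t tF.
  exists (coord x) => psi /tP[->|[P [phi [Pt phiP ->]]]].
    by rewrite sat_rename; apply/sat_domF; exists x.
  by rewrite sat_rename E phiP; exact: xP.
have /sat_rename/sat_domF[a ax] := xP _ (or_introl erefl).
exists a => P FP; have [phi phiP] := dF P FP.
rewrite -phiP -E -sat_rename ax; apply: xP; right.
by exists P, phi.
Qed.

Lemma card_lt_unit : card_lt [set: unit] [set: K].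
Proof. exact/card_lt_finite_K/finite_finset. Qed.

Lemma saturation_dsets (F : set (set G')) : (forall D, F D -> dset D) ->
  (forall s, (forall D, List.In D s -> F D) -> exists x, forall D, List.In D s -> D x) ->
  exists x, forall D, F D -> D x.
Proof.
move=> dF fs.
have [||a aP] := @saturation unit (fun=> 1)
   [set P | exists D, F D /\ P = (fun v => D (v None))] card_lt_unit.
- by move=> _ [D [FD ->]]; have dD := dF D FD; defi.
- move=> s sP.
  have [t [tF tP]] : exists t : seq (set G'), (forall D, List.In D t -> F D) /\
      forall P, List.In P s -> exists D, List.In D t /\ P = (fun v => D (v None)).
    elim: s sP => [|P s IH] sP; first by exists [::].
    have [|t [t1 t2]] := IH; first by move=> ? ?; apply: sP; right.
    have [D [FD PE]] := sP P (or_introl erefl).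
    exists (D :: t); split; first by move=> ? [<-|/t1].
    by move=> Q [<-|/t2[E [? ->]]]; [exists D|exists E]; split => //; [left|right].
  have [x xP] := fs t tF.
  by exists x => Q /tP[D [tD ->]]; exact: xP.
by exists a => D FD; apply: (aP (fun v => D (v None))); exists D.
Qed.

Definition same_type (x y : G') : Prop := forall D, dset D -> D x -> D y.

Lemma same_type_sym x y : same_type x y -> same_type y x.
Proof.
move=> xy D dD Dy; apply: contrapT => nD.
by have := xy (~` D) (definable_not dD) nD; apply.
Qed.

Lemma same_type_trans y x z : same_type x y -> same_type y z -> same_type x z.
Proof. by move=> xy yz D dD /(xy D dD)/(yz D dD). Qed.

(** Sending [coord x] to [coord y] and fixing M is elementary, so strong homogeneity extends it to
    an automorphism over M. *)
Lemma same_type_invariant A x y : M_invariant A -> same_type x y -> A x -> A y.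
Proof.
move=> invA xy Ax; have [_ _ homK] := hK.
pose B := range (@emb L S) `|` range (coord x).
have sB : card_lt B [set: K].
  apply: card_lt_setU_K; first exact: card_lt_emb.
  by apply: card_lt_finite_K; apply: finite_image; exact: finite_finset.
(* A coordinate of [x] may coincide with another one or with a point of M, so each element of [B]
   gets one name [r b]; [tpI] makes the choice harmless. *)
have /choice[r rP] : forall b : B, exists i : 'I_n + M S, env (coord x) (@emb L S) i = val b.
  move=> b; have [[m _ mb]|[i _ ib]] := set_mem (valP b); first by exists (inr m).
  by exists (inl i).
have tpE (phi : Mformula S) :
    sat (env (coord x) (@emb L S)) phi <-> sat (env (coord y) (@emb L S)) phi.
  split; first exact: (xy _ (dset_defMstar phi)).
  exact: (same_type_sym xy (dset_defMstar phi)).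
have tpI i j : env (coord x) (@emb L S) i = env (coord x) (@emb L S) j ->
    env (coord y) (@emb L S) i = env (coord y) (@emb L S) j.
  by move=> ij; have /tpE := ij : sat (env (coord x) (@emb L S)) (Eq (Var L i) (Var L j)).
pose f (b : B) : Mstar S := env (coord y) (@emb L S) (r b).
have xE : env (coord x) (@emb L S) \o r = val by apply/funext.
have [|s sa sf] := homK B f sB.
  by move=> phi; rewrite -xE -!sat_rename tpE sat_rename.
have Bx i : coord x i \in B by apply: mem_set; right; exists i.
have Be m : emb m \in B by apply: mem_set; left; exists m.
have sE m : s (emb m) = emb m.
  rewrite (sf (exist (fun x => x \in B) _ (Be m))) /f; apply: (tpI _ (inr m)).
  by rewrite rP.
have sx : s \o coord x = coord y.
  apply/funext => i /=; rewrite (sf (exist (fun x => x \in B) _ (Bx i))) /f; apply: (tpI _ (inl i)).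
  by rewrite rP.
have := invA s sa sE => /seteqP[+ _] => /(_ (coord y))[].
  by exists (coord x); [exists x|].
by move=> z Az /coord_inj <-.
Qed.

(** By elementarity every definable set containing [a] meets G(M), so the type of [a] generates a
    proper filter on G(M). *)
Lemma generic_ultrafilter (a : G') : exists F : set_system G,
  UltraFilter F /\ forall D, dset D -> D a -> F [set g | D (incl g)].
Proof.
pose F0 : set_system G := [set X | exists D, [/\ dset D, D a & [set g | D (incl g)] `<=` X]].
have pF0 : ProperFilter F0.
  split.
    move=> [D [dD Da D0]]; have [|g /D0//] := transfer1 dD.
    by exists a.
  split.
  - by exists setT; split => //; exact: definable_True.
  - move=> X Y [D [dD Da DX]] [D' [dD' Da' DY]].
    exists (D `&` D'); split => //; first exact: definable_and.
    by move=> g [/DX ? /DY ?].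
  - by move=> X Y XY [D [dD Da DX]]; exists D; split => //; exact: subset_trans XY.
have [F [uF F0F]] := ultraFilterLemma pF0.
by exists F; split => // D dD Da; apply: F0F; exists D; split.
Qed.

(* [b] realizes over [M] and [u] the coheir defined by the ultrafilter [F]. *)
Lemma coheir (F : set_system G) J (u : J -> G') : UltraFilter F ->
  card_lt [set: J] [set: K] ->
  exists b, forall P : (option J -> G') -> Prop, definable P ->
    (P (scons b u) <-> F [set g | P (scons (incl g) u)]).
Proof.
move=> uF sJ.
have [||b bP] := @saturation J u [set P | definable P /\ F [set g | P (scons (incl g) u)]] sJ.
- by move=> P [].
- move=> s sF.
  have : F [set g | forall P, List.In P s -> P (scons (incl g) u)].
    elim: s sF => [|P s IH] sF.
      by apply: filterS filterT => g _ P [].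
    have FP : F [set g | P (scons (incl g) u)] by have [] := sF P (or_introl erefl).
    apply: filterS (filterI FP (IH (fun Q Qs => sF Q (or_intror Qs)))).
    by move=> g [Pg sg] Q [<-|/sg].
  by move=> /filter_ex[g gP]; exists (incl g).
exists b => P dP; split=> [Pb|FP]; last exact: bP.
have [//|nF] := in_ultra_setVsetC [set g | P (scons (incl g) u)] uF.
by have := bP (fun v => ~ P v) (conj (definable_not dP) nF).
Qed.

End Monster.

(** * The subgroup generated by the differences of elements of the same type *)

Section Subgroups.
Variable H : groupType.
Implicit Types A B X : set H.

Lemma smallest_subgroup X : subgroup (smallest (@subgroup H) X).
Proof.
split=> [B [[]]//|x y Hx Hy B BX|x Hx B BX].
- by have [[_ mB _] _] := BX; apply: mB; [exact: Hx|exact: Hy].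
- by have [[_ _ vB] _] := BX; apply: vB; exact: Hx.
Qed.

Lemma smallest_subgroup_sub X A : subgroup A -> X `<=` A -> smallest (@subgroup H) X `<=` A.
Proof. by move=> sA XA x; apply. Qed.

Lemma sub_smallest_subgroup X : X `<=` smallest (@subgroup H) X.
Proof. exact: sub_gen_smallest. Qed.

Fixpoint powset (X : set H) (k : nat) : set H :=
  if k is k'.+1 then mulset (powset X k') X else [set 1].

Lemma smallest_powset X : (forall x, X x -> X x^-1) ->
  smallest (@subgroup H) X `<=` \bigcup_k powset X k.
Proof.
move=> XV.
have powD k l x y : powset X k x -> powset X l y -> powset X (k + l)%N (x * y).
  elim: l y => [|l IH] y kx; first by move=> ->; rewrite mulg1 addn0.
  by move=> [z lz [w Xw <-]]; rewrite addnS mulgA; exists (x * z); [exact: IH|exists w].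
have pow1 x : X x -> powset X 1 x by move=> Xx; exists 1 => //; exists x; rewrite ?mul1g.
apply: smallest_subgroup_sub; last by move=> x Xx; exists 1%N => //; exact: pow1.
split; first by exists 0%N.
- by move=> x y [k _ kx] [l _ ly]; exists (k + l)%N => //; exact: powD.
- move=> x [k _]; elim: k x => [|k IH] x; first by move=> ->; exists 0%N; rewrite // invg1.
  move=> [z kz [w Xw <-]]; have [l _ lz] := IH z kz.
  by exists (1 + l)%N => //; rewrite invgM; apply: powD => //; exact/pow1/XV.
Qed.

End Subgroups.

Section TypeDifferences.
Variables (K : Type) (L : signature) (S : defGroup L).
Hypothesis hK : monster K S.
Local Notation G := (GM S).
Local Notation G' := (GMstar S).
Implicit Types A B D : set G'.

Definition tydiff : set G' := [set x | exists a b, same_type a b /\ x = a^-1 * b].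

Definition Ntydiff : set G' := smallest (@subgroup G') tydiff.

Lemma same_type_inv (a b : G') : same_type a b -> same_type a^-1 b^-1.
Proof.
move=> ab D dD Da; apply: (ab (fun x => D x^-1)) => //.
by rewrite /dset; defi.
Qed.

Lemma tydiffV x : tydiff x -> tydiff x^-1.
Proof.
move=> [a [b [ab ->]]]; exists b, a; split; first exact: same_type_sym.
by rewrite invgM invgK.
Qed.

Lemma tydiff_right (a b : G') : same_type a b -> tydiff (a * b^-1).
Proof. by move=> /same_type_inv ab; exists a^-1, b^-1; rewrite invgK. Qed.

Lemma card_lt_option J : card_lt [set: J] [set: K] -> card_lt [set: option J] [set: K].
Proof.
move=> sJ; apply: (card_lt_le (B := range Some `|` [set None])).
  by apply: subset_card_le => -[j|] _; [left; exists j|right].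
apply: (card_lt_setU_K hK); last exact: (card_lt_finite_K hK).
exact: card_lt_le (card_image_le _ _) sJ.
Qed.

(** Let [r] choose representatives of the cosets of [A], few enough by bounded index. Let [c]
    realize the coheir over [r], and [c2] over [r] and [c]. If r0 represents the coset of [c], then
    r0^-1 c and r0^-1 c2 have the same type, so [c2] is in that coset too and [c^-1 * c2] is in [A].
    A realization [c'] of the coheir over [a] and [b] stands to each of them as [c2] stands to [c],
    so [a^-1 * c'] and [b^-1 * c'] are in [A]. *)
Lemma tydiff_sub_invariant A : subgroup A -> M_invariant A -> bounded_index K A ->
  tydiff `<=` A.
Proof.
move=> [A1 AM AV] invA bA _ [a [b [ab ->]]].
pose C := range (fun g : G' => [set g * x | x in A]).
have sC : card_lt [set: C] [set: K].
  by apply: card_lt_le bA; have /card_eqPle[] := card_setT C.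
have /choice[r rP] : forall c : C, exists g : G', [set g * x | x in A] = val c.
  by move=> c; have [g _ gc] := set_mem (valP c); exists g.
have [F [uF Fa]] := generic_ultrafilter a.
have [c cP] := coheir hK r uF sC.
have [c2 c2P] := coheir hK (scons c r) uF (card_lt_option sC).
have fab : card_lt [set: bool] [set: K] by exact/(card_lt_finite_K hK)/finite_finset.
have [c' c'P] := coheir hK (fun i : bool => if i then a else b) uF fab.
have ac : same_type a c.
  move=> D dD /(Fa D dD) FD.
  by apply/(cP (fun v => D (v None))) => //; defi.
have Cc : [set c * x | x in A] \in C by apply: mem_set; exists c.
pose c0 : C := exist (fun x => x \in C) _ Cc.
have rc : A ((r c0)^-1 * c).
  have := rP c0; rewrite /= => /seteqP[_ /(_ c)][|x Ax <-]; last by rewrite mulKg.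
  by exists 1; rewrite ?mulg1.
have rc2 : A ((r c0)^-1 * c2).
  apply: (same_type_invariant hK invA) rc => D dD.
  have d1 : definable (fun v : option C -> G' => D ((v (Some c0))^-1 * v None)) by defi.
  have d2 : definable (fun v : option (option C) -> G' => D ((v (Some (Some c0)))^-1 * v None)).
    by defi.
  by move=> /(cP _ d1) H; apply/(c2P _ d2).
have cc2 : A (c^-1 * c2).
  by have := AM _ _ (AV _ rc) rc2; rewrite invgM invgK -mulgA mulVKg.
have key x i : same_type x c -> (if i then a else b) = x -> A (x^-1 * c').
  move=> xc ix; apply: (same_type_invariant hK invA) cc2 => D dD.
  have d1 : definable (fun v : option bool -> G' => D ((v (Some i))^-1 * v None)) by defi.
  have d2 : definable (fun v : option (option C) -> G' => D ((v (Some None))^-1 * v None)) by defi.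
  move=> /(c2P _ d2) H; rewrite -{1}ix; apply/(c'P _ d1) => /=; apply: filterS H => g /=.
  rewrite ix; apply: (same_type_sym xc (D := fun y => D (y^-1 * incl g))).
  by rewrite /dset; defi.
have := AM _ _ (key a true ac erefl) (AV _ (key b false (same_type_trans (same_type_sym ab) ac) erefl)).
by rewrite invgM invgK -mulgA mulVKg.
Qed.

Lemma Ntydiff_sub_invariant A : subgroup A -> M_invariant A -> bounded_index K A ->
  Ntydiff `<=` A.
Proof.
by move=> sA iA bA; apply: smallest_subgroup_sub => //; exact: tydiff_sub_invariant.
Qed.

Lemma subgroup_Ntydiff : subgroup Ntydiff. Proof. exact: smallest_subgroup. Qed.

Lemma tydiff_Ntydiff : tydiff `<=` Ntydiff. Proof. exact: sub_smallest_subgroup. Qed.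

(* Conjugation by [y] is conjugation by a realization [y'] of a coheir of the
   type of [y], for which [a * y'] and [b * y'] still have the same type, up to
   an element of [Ntydiff]. *)
Lemma Ntydiff_conj x y : Ntydiff x -> Ntydiff (y^-1 * x * y).
Proof.
have [N1 NM NV] := subgroup_Ntydiff.
move=> Nx; apply: (Nx [set x | Ntydiff (y^-1 * x * y)]); split.
  split=> /=.
  - by rewrite mulg1 mulVg.
  - by move=> z w Hz Hw; have := NM _ _ Hz Hw; rewrite !mulgA mulgK.
  - by move=> z /NV; rewrite !invgM invgK mulgA.
move=> _ [a [b [ab ->]]] /=.
have [F [uF Fy]] := generic_ultrafilter y.
have fab : card_lt [set: bool] [set: K] by exact/(card_lt_finite_K hK)/finite_finset.
have [y' y'P] := coheir hK (fun i : bool => if i then a else b) uF fab.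
have yy' : same_type y y'.
  by move=> D dD /(Fy D dD) FD; apply/(y'P (fun v => D (v None))) => //; defi.
have aby : same_type (a * y') (b * y').
  move=> D dD Da.
  have d1 i : definable (fun v : option bool -> G' => D (v (Some i) * v None)) by defi.
  have {}Da := Da : D ((if true then a else b) * y').
  apply/(y'P _ (d1 false)) => /=; move: Da => /(y'P _ (d1 true)) /=.
  apply: filterS => g /=; apply: (ab (fun z => D (z * incl g))).
  by rewrite /dset; defi.
have e1 : Ntydiff (y'^-1 * y).
  by apply: tydiff_Ntydiff; exists y', y; split => //; exact: same_type_sym.
have e2 : Ntydiff ((a * y')^-1 * (b * y')) by apply: tydiff_Ntydiff; exists (a * y'), (b * y').
have := NM _ _ (NM _ _ (NV _ e1) e2) e1.
by rewrite !invgM invgK !mulgA !mulgK.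
Qed.

End TypeDifferences.

(** * Infinitesimals and connected components *)

Lemma automorphism_teval L (N : structure L) (s : N -> N) V (v : V -> N) (t : term L V) :
  automorphism s -> teval (s \o v) t = s (teval v t).
Proof.
move=> [_ sf _]; elim: t => //= f ts IH; rewrite sf; congr finterp.
by apply/funext => i /=.
Qed.

Lemma automorphism_sat L (N : structure L) (s : N -> N) (V : Type) (phi : formula L V) (v : V -> N) :
  automorphism s -> sat (s \o v) phi <-> sat v phi.
Proof.
move=> autos; have [[t sK tK] _ sr] := autos.
elim: phi v => {V} [V|V t1 t2|V r ts|V a IHa b IHb|V a IH] v //=.
- by rewrite !automorphism_teval //; split=> [/(can_inj sK)|->].
- rewrite -[X in _ <-> X]sr; set x1 := fun i => _; set x2 := _ \o _.
  suff -> : x1 = x2 by [].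
  by apply/funext => i; exact: automorphism_teval.
- by rewrite IHa IHb.
- have E x : s \o scons x v = scons (s x) (s \o v) by apply/funext => -[].
  by split=> H x; [apply/IH; rewrite E|rewrite -[x]tK -E; apply/IH].
Qed.

Section Components.
Variables (K : Type) (L : signature) (S : defGroup L).
Hypothesis hK : monster K S.
Local Notation G := (GM S).
Local Notation G' := (GMstar S).
Local Notation N := (@Ntydiff L S).
Implicit Types A B D : set G'.

Lemma type_definable_invariant A : M_type_definable A -> M_invariant A.
Proof.
move=> [p ->] s autos sE; have [[t sK tK] _ _] := autos.
have E (x : 'I_(dim S) -> Mstar S) : s \o env x (@emb L S) = env (s \o x) (@emb L S).
  by apply/funext => -[//|m] /=; rewrite sE.
have tE (x : 'I_(dim S) -> Mstar S) : s \o (t \o x) = x by apply/funext => i /=; rewrite tK.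
apply/seteqP; split=> [_ [_ [a pa <-] <-]|_ [a pa <-]].
  have /sat_domF[b bE] : sat (s \o coord a) (domF S).
    by apply/(automorphism_sat _ _ autos)/sat_domF; exists a.
  exists b => // phi pphi; rewrite /defMstar /= bE -E.
  by apply/(automorphism_sat _ _ autos); exact: pa.
have /sat_domF[b bE] : sat (t \o coord a) (domF S).
  by apply/(automorphism_sat _ _ autos); rewrite tE; apply/sat_domF; exists a.
exists (coord b); last by rewrite bE tE.
exists b => // phi pphi; apply/(automorphism_sat _ _ autos).
by rewrite E bE tE; exact: pa.
Qed.

(** Elements of the same type over M lie in the same left coset of [A], so there are no more cosets
    than types. *)
Lemma bounded_index_tydiff A : subgroup A -> @tydiff L S `<=` A -> bounded_index K A.
Proof.
move=> [A1 AM AV] EA; apply: card_lt_le (card_lt_types hK).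
pose C := range (fun g : G' => [set g * x | x in A]).
have /choice[r rP] : forall c : C, exists g : G', [set g * x | x in A] = val c.
  by move=> c; have [g _ gc] := set_mem (valP c); exists g.
apply/card_le_injP.
exists (fun c : C => exist (fun x => x \in [set: set (Mformula S)])
  [set phi | defMstar phi (r c)] (mem_set I)).
move=> c d [] cd; apply: val_inj; rewrite -!rP.
have tcd : same_type (r c) (r d).
  move=> D /dsetP[phi ->] Dc.
  by have : [set phi | defMstar phi (r d)] phi by rewrite -cd.
have Acd : A ((r c)^-1 * r d) by apply: EA; exists (r c), (r d).
have Adc : A ((r d)^-1 * r c) by have := AV _ Acd; rewrite invgM invgK.
apply/seteqP; split=> _ [x Ax <-].
  by exists ((r d)^-1 * r c * x); [exact: AM|rewrite !mulgA mulgV mul1g].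
by exists ((r c)^-1 * r d * x); [exact: AM|rewrite !mulgA mulgV mul1g].
Qed.

Lemma Ntydiff_sub_G000 : N `<=` G000 K S.
Proof. by move=> x Nx A [[sA iA bA] _]; exact: (Ntydiff_sub_invariant hK sA iA bA Nx). Qed.

Lemma G000_sub_G00 : G000 K S `<=` G00 K S.
Proof.
move=> x Hx A [[sA tA bA] A0]; apply: Hx; split=> //; split => //.
exact: type_definable_invariant.
Qed.

Definition mnbhs D : Prop := dset D /\ nbhs (1 : G) [set g | D (incl g)].

Lemma muP x : mu S x <-> forall D, mnbhs D -> D x.
Proof.
split=> [mx D [/dsetP[phi ->] D1]|H phi phi1].
  by apply: mx; apply: filterS D1 => g; exact: (defM_incl phi g).2.
apply: (H (defMstar phi)); split; first exact: dset_defMstar.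
by apply: filterS phi1 => g; exact: (defM_incl phi g).1.
Qed.

Lemma mu_sub D : mnbhs D -> mu S `<=` D.
Proof. by move=> nD x /muP; apply. Qed.

Lemma mnbhsI D D' : mnbhs D -> mnbhs D' -> mnbhs (D `&` D').
Proof.
by move=> [dD D1] [dD' D1']; split; [exact: definable_and|exact: filterI].
Qed.

Lemma mnbhsT : mnbhs setT.
Proof. by split; [exact: definable_True|exact: filterT]. Qed.

Lemma mnbhs1 D : mnbhs D -> D 1.
Proof. by move=> [_ /nbhs_singleton] /=; rewrite incl1. Qed.

Lemma mnbhsV D : mnbhs D -> mnbhs [set x | D x^-1].
Proof.
move=> [dD D1]; split; first by rewrite /dset /=; defi.
have : nbhs (1 : G)^-1 [set g | D (incl g)] by rewrite invg1.
move/(@invg_cts (GM S) 1) => H.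
have {}H : nbhs (1 : G) ((fun g => g^-1) @^-1` [set g : G | D (incl g)]) by [].
by apply: filterS H => g /=; rewrite inclV.
Qed.

(** Continuity gives this only for [h] in G(M); conjugation by other elements of G(Mstar) need not
    preserve [mu]. *)
Lemma mnbhs_conj (h : G) D : mnbhs D -> mnbhs [set x | D (incl h * x * (incl h)^-1)].
Proof.
move=> [dD D1]; split; first by rewrite /dset /=; defi.
have c1 : continuous (fun x : G => h * x).
  move=> x; apply: (@continuous2_cvg _ _ _ _ _ _ (fun=> h) id _ h x).
  - exact: (@mulg_cts (GM S) (h, x)).
  - exact: cvg_cst.
  - exact: cvg_id.
have c2 : continuous (fun x : G => h * x * h^-1).
  move=> x; apply: (@continuous2_cvg _ _ _ _ _ _ (fun x => h * x) (fun=> h^-1) _ (h * x) h^-1).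
  - exact: (@mulg_cts (GM S) (h * x, h^-1)).
  - exact: c1.
  - exact: cvg_cst.
have : nbhs (h * 1 * h^-1 : G) [set g | D (incl g)] by rewrite mulg1 mulgV.
move/c2 => H.
have {}H : nbhs (1 : G) ((fun g => h * g * h^-1) @^-1` [set g : G | D (incl g)]) by [].
by apply: filterS H => g /=; rewrite !inclM inclV.
Qed.

Hypothesis basis : definable_basis S.

(** Here the definable basis enters: continuity yields arbitrary neighbourhoods, which are shrunk to
    a definable one so that the inclusion can be checked on G(M) and transferred. *)
Lemma mnbhs_mul D : mnbhs D -> exists2 D', mnbhs D' & mulset D' D' `<=` D.
Proof.
move=> [dD D1].
have : nbhs ((1 : G) * 1) [set g | D (incl g)] by rewrite mulg1.
move/(@mulg_cts (GM S) (1, 1)) => [[U V] /= [U1 V1] UV].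
have [phi phi1 phiUV] := basis (filterI U1 V1).
exists (defMstar phi).
  split; first exact: dset_defMstar.
  by apply: filterS phi1 => g; exact: (defM_incl phi g).1.
apply: transfer_sub => //; first by apply: dset_mulset; exact: dset_defMstar.
move=> g [x px [y py xyg]].
(* The factors of [g] lie in G(Mstar), where continuity says nothing; they are replaced by factors
   in G(M). *)
have [||v [p0 [p1 vg]]] := @transfer_tuple L S 2
  (fun v => defMstar phi (v ord0) /\ defMstar phi (v ord_max) /\ v ord0 * v ord_max = incl g).
- have dphi := dset_defMstar phi; by defi.
- by exists (tcons x (fun=> y)); rewrite /tcons unlift_none; case: unliftP.
have /UV : (U `*` V) (v ord0, v ord_max).
  split=> /=; first by have /phiUV[] := (defM_incl phi _).2 p0.
  by have /phiUV[] := (defM_incl phi _).2 p1.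
by rewrite /= inclM vg.
Qed.

Lemma subgroup_mu : subgroup (mu S).
Proof.
split=> [|x y /muP mx /muP my|x /muP mx]; apply/muP => D nD.
- exact: mnbhs1.
- by have [D' nD' D'D] := mnbhs_mul nD; apply: D'D; exists x; [exact: mx|exists y => //; exact: my].
- exact: mx (mnbhsV nD).
Qed.

Lemma mu_conj_incl (h : G) x : mu S x -> mu S (incl h * x * (incl h)^-1).
Proof. by move=> /muP mx; apply/muP => D nD; exact: mx (mnbhs_conj h nD). Qed.

Lemma subgroup_muN : subgroup (mulset (mu S) N).
Proof.
have [m1 mM mV] := subgroup_mu; have [N1 NM NV] := subgroup_Ntydiff S.
split.
- by exists 1 => //; exists 1; rewrite ?mulg1.
- move=> _ _ [a ma [x Nx <-]] [b mb [y Ny <-]].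
  exists (a * b); first exact: mM.
  exists (b^-1 * x * b * y); last by rewrite !mulgA mulgK.
  by apply: NM => //; exact: (Ntydiff_conj hK).
- move=> _ [a ma [x Nx <-]]; exists a^-1; first exact: mV.
  exists (a^-1^-1 * x^-1 * a^-1); first by apply: (Ntydiff_conj hK); exact: NV.
  by rewrite invgK invgM !mulgA mulVg mul1g.
Qed.

(* [g'] realizes a coheir of the type of [g] over [m], so that the conjugate of
   [m] by [g'] is still infinitesimal; and [g] is in [N * g']. *)
Lemma mu_conj_sub_muN : mu_conj S `<=` mulset (mu S) N.
Proof.
have [N1 NM NV] := subgroup_Ntydiff S.
move=> _ [m mm [g _ <-]].
have [F [uF Fg]] := generic_ultrafilter g.
have funit : card_lt [set: unit] [set: K] by exact/(card_lt_finite_K hK)/finite_finset.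
have [g' g'P] := coheir hK (fun=> m) uF funit.
have gg' : same_type g g'.
  by move=> D dD /(Fg D dD) FD; apply/(g'P (fun v => D (v None))) => //; defi.
have mg' : mu S (g' * m * g'^-1).
  apply/muP => D nD; have dD := nD.1.
  have d1 : definable (fun v : option unit -> G' => D (v None * v (Some tt) * (v None)^-1)) by defi.
  apply/(g'P _ d1) => /=; apply: filterS filterT => h _ /=.
  by move: (mu_conj_incl h mm) => /muP; exact.
have e : N (g * g'^-1) by apply: tydiff_Ntydiff; exact: tydiff_right.
set e0 := g * g'^-1 in e; set m' := g' * m * g'^-1 in mg'.
(* The conjugate is [e0 * m' * e0^-1], that is, [m'] times a commutator, which lies in the normal
   subgroup [N] because [e0] does. *)
exists m' => //; exists (m'^-1 * e0 * m' * e0^-1).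
  by apply: NM; [exact: (Ntydiff_conj hK)|exact: NV].
rewrite !mulgA mulgV mul1g /m' /e0 invgM invgK !mulgA.
by rewrite !mulgVK.
Qed.

(** One inclusion combines the hypothesis with [N] inside [G000]. The other holds because mu N is a
    group containing all conjugates of [mu], and [N] is inside [G00]. *)
Lemma G00_top_eq_of_sub : G00 K S `<=` mulset (mu S) N -> G00_top K S = G000_top K S.
Proof.
move=> G00N; have [m1 mM mV] := subgroup_mu.
have N0 := Ntydiff_sub_G000; have N00 := subset_trans N0 G000_sub_G00.
have G00M x y : G00 K S x -> G00 K S y -> G00 K S (x * y).
  by move=> Hx Hy A HA; case: (HA) => [[[_ AM _] _ _] _]; apply: AM; [exact: Hx|exact: Hy].
apply/seteqP; split=> _ [a ma [x Gx <-]].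
  have [b mb [y Ny <-]] := G00N _ Gx.
  exists (a * b); last by exists y; [exact: N0|rewrite mulgA].
  apply: sub_smallest_subgroup; exists (a * b); first exact: mM.
  by exists 1 => //; rewrite mul1g invg1 mulg1.
have [b mb [y Ny <-]] := smallest_subgroup_sub subgroup_muN mu_conj_sub_muN ma.
exists b => //; exists (y * x); last by rewrite mulgA.
by apply: G00M; [exact: N00|exact: G000_sub_G00].
Qed.

Lemma G00_sub_muN : M_type_definable (mulset (mu S) N) -> G00 K S `<=` mulset (mu S) N.
Proof.
move=> tN; have [m1 _ _] := subgroup_mu; apply: smallest_sub => //; split => //.
  exact: subgroup_muN.
apply: bounded_index_tydiff; first exact: subgroup_muN.
by move=> x Ex; exists 1 => //; exists x; rewrite ?mul1g //; exact: tydiff_Ntydiff.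
Qed.

End Components.

(** * Large sets *)

Section Largeness.
Variables (L : signature) (S : defGroup L).
Local Notation G := (GM S).
Local Notation G' := (GMstar S).
Implicit Types A B C D Y : set G'.

Definition trans (a : G') (B : set G') : set G' := [set y | B (a^-1 * y)].

Lemma transM a b B : trans a (trans b B) = trans (a * b) B.
Proof. by apply/seteqP; split=> y; rewrite /trans /= invgM mulgA. Qed.

Lemma trans1 B : trans 1 B = B.
Proof. by apply/seteqP; split=> y; rewrite /trans /= invg1 mul1g. Qed.

(* Having measure at least [t] implies being large for a list [s] depending only
   on [t] and on its prescribed length; see [rho_largeM]. *)
Fixpoint large (s : seq nat) (B : set G') : Prop :=
  if s is N :: s' then
    forall x : 'I_N -> G', exists i j : 'I_N,
      (i < j)%N /\ large s' (trans (x i) B `&` trans (x j) B)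
  else exists y, B y.

(** Only translates by G(M) occur, those under which [rho] is invariant; the sets concerned, such as
    mu X, need not be definable. *)
Fixpoint largeM (s : seq nat) (B : set G') : Prop :=
  if s is N :: s' then
    forall x : 'I_N -> G, exists i j : 'I_N,
      (i < j)%N /\ largeM s' (trans (incl (x i)) B `&` trans (incl (x j)) B)
  else exists y, B y.

Lemma large_nonempty s B : large s B -> exists y, B y.
Proof.
elim: s B => [//|N s IH] B /= /(_ (fun=> 1)) [i [j [_ /IH[y [By _]]]]].
by exists (1^-1 * y).
Qed.

Lemma large_trans s a B : large s B -> large s (trans a B).
Proof.
case: s => [[y By]|N s HB x]; first by exists (a * y); rewrite /trans /= mulKg.
by have [i [j H]] := HB (fun i => x i * a); exists i, j; rewrite !transM.
Qed.

Lemma definable_fin_ex (N : nat) V (P : 'I_N -> (V -> G') -> Prop) :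
  (forall i, definable (P i)) -> definable (fun v => exists i, P i v).
Proof.
elim: N P => [|N IH] P dP.
  by apply: definable_iff (@definable_False _ _ V) => v; split=> // -[[]].
apply: definable_iff (definable_or (dP ord0) (IH _ (fun i => dP (lift ord0 i)))) => v.
split=> [[?|[i ?]]|[i]]; [by exists ord0|by exists (lift ord0 i)|].
by case: (unliftP ord0 i) => [j|] -> ?; [right; exists j|left].
Qed.

(** Each level of [large] is a quantifier over [N] group elements followed by a finite disjunction,
    so largeness is definable uniformly in the parameters of the set. *)
Lemma large_definable s V (Q : G' -> (V -> G') -> Prop) :
  definable (fun w : option V -> G' => Q (w None) (fun i => w (Some i))) ->
  definable (fun v => large s [set y | Q y v]).
Proof.
elim: s V Q => [|N s IH] V Q dQ; first exact: definable_ex.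
apply: (@definable_all_tuple _ _ N _ (fun x v => exists i j : 'I_N, (i < j)%N /\
   large s (trans (x i) [set y | Q y v] `&` trans (x j) [set y | Q y v]))).
apply: definable_fin_ex => i; apply: definable_fin_ex => j.
apply: definable_and; first exact: definable_cst.
apply: (IH _ (fun y w => Q ((w (inl i))^-1 * y) (fun k => w (inr k)) /\
    Q ((w (inl j))^-1 * y) (fun k => w (inr k)))).
have d k : definable (fun w : option ('I_N + V) -> G' =>
    Q ((w (Some (inl k)))^-1 * w None) (fun l => w (Some (inr l)))).
  have dt : dterm (fun w : option ('I_N + V) -> G' => (w (Some (inl k)))^-1 * w None).
    by dterm_tac.
  exact: (definable_subst (definable_rename (omap (fun l => Some (inr l))) dQ) dt).
exact: definable_and.
Qed.

Lemma dset_trans (a : G) B : dset B -> dset (trans (incl a) B).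
Proof. by move=> dB; rewrite /dset /trans /=; defi. Qed.

(** For a definable [B] largeness is first-order, so it may be tested on translates by G(M), where
    it is inherited from the smaller set [Y]. *)
Lemma large_of_largeM s Y B : dset B -> Y `<=` B -> largeM s Y -> large s B.
Proof.
elim: s Y B => [|N s IH] Y B dB YB /=; first by move=> [y /YB By]; exists y.
move=> HY; apply: transfer_all_tuple.
  apply: definable_fin_ex => i; apply: definable_fin_ex => j; apply: definable_and.
    exact: definable_cst.
  apply: (@large_definable s _ (fun y v => B ((v i)^-1 * y) /\ B ((v j)^-1 * y))).
  by defi.
move=> v; have [i [j [ij H]]] := HY v; exists i, j; split => //.
apply: IH H.
  by apply: definable_and; exact: (dset_trans _ dB).
by move=> y [/YB ? /YB ?].
Qed.

(* Take a maximal family of translates without large pairwise intersections. *)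
Lemma large_generic N s B : dset B -> large (N :: s) B ->
  exists m (x : 'I_m -> G), forall y, exists j : 'I_m,
    large s (trans ((incl (x j))^-1 * y) B `&` B).
Proof.
move=> dB BN.
pose free m (x : 'I_m -> G') := forall i j : 'I_m, (i < j)%N ->
  ~ large s (trans (x i) B `&` trans (x j) B).
have dfree m : definable (@free m).
  have : definable (fun x : 'I_m -> G' => ~ exists i j : 'I_m, (i < j)%N /\
      large s (trans (x i) B `&` trans (x j) B)).
    apply: definable_not; apply: definable_fin_ex => i; apply: definable_fin_ex => j.
    apply: definable_and.
      exact: definable_cst.
    apply: (@large_definable s _ (fun y v => B ((v i)^-1 * y) /\ B ((v j)^-1 * y))).
    by defi.
  apply: definable_iff => x; split=> [H i j ij l|H [i [j [ij l]]]].
    by apply: H; exists i, j.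
  exact: (H i j).
have [m [[x xfree] mmax]] : exists m, (exists x, @free m x) /\ ~ exists x, @free m.+1 x.
  apply: contrapT => nE.
  have all_free m : exists x, @free m x.
    elim: m => [|m [x xf]]; first by exists (@from_I0 _) => -[].
    by apply: contrapT => nf; apply: nE; exists m; split => //; exists x.
  have [x xf] := all_free N; have [i [j [ij H]]] := BN x; exact: (xf i j).
(* The length [m] is maximal in G(Mstar), and a free family of this length already exists in G(M);
   adding any [y] to it destroys freeness. *)
have [z zfree] := transfer_tuple (dfree m) (ex_intro _ x xfree).
exists m, z => y; apply: contrapT => nH; apply: mmax.
exists (tcons y (fun i => incl (z i))) => i j; rewrite /tcons.
case: (unliftP ord0 i) => [i'|] ->; case: (unliftP ord0 j) => [j'|] -> // ij.
  by apply: zfree; move: ij; rewrite !lift0.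
move=> /(large_trans (incl (z j'))^-1) H; apply: nH; exists j'.
have E A A' a : trans a (A `&` A') = trans a A `&` trans a A' by [].
by move: H; rewrite E !transM mulVg trans1.
Qed.

End Largeness.

(** * Type-definable sets *)

Section TypeDefinable.
Variables (K : Type) (L : signature) (S : defGroup L).
Hypothesis hK : monster K S.
Local Notation G := (GM S).
Local Notation G' := (GMstar S).
Implicit Types A B C D X Y : set G'.

Definition invset A : set G' := [set x | A x^-1].

Lemma dset_invset A : dset A -> dset (invset A).
Proof. by move=> dA; rewrite /dset /invset /=; defi. Qed.

Definition tdset A : Prop := forall x, (forall D, dset D -> A `<=` D -> D x) -> A x.

Lemma dset_tdset D : dset D -> tdset D.
Proof. by move=> dD x; apply. Qed.

Lemma mulsetS A A' B B' : A `<=` A' -> B `<=` B' -> mulset A B `<=` mulset A' B'.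
Proof. by move=> AA' BB' _ [x Ax [y By <-]]; exists x; [exact: AA'|exists y => //; exact: BB']. Qed.

Section Directed.
Variables (I : Type) (le : I -> I -> Prop) (i0 : I).
Hypothesis le_refl : forall i, le i i.
Hypothesis le_directed : forall i j, exists k, le k i /\ le k j.
Hypothesis le_trans : forall i j k, le i j -> le j k -> le i k.

Definition monotone_dsets (f : I -> set G') : Prop :=
  (forall i, dset (f i)) /\ (forall i j, le i j -> f i `<=` f j).

Lemma lower_bound (T : Type) (s : seq T) (P : T -> I -> Prop) :
  (forall t, List.In t s -> exists i, forall j, le j i -> P t j) ->
  exists i, forall t, List.In t s -> P t i.
Proof.
move=> H; suff [i iP] : exists i, forall t, List.In t s -> forall j, le j i -> P t j.
  by exists i => t ts; exact: (iP t ts i (le_refl i)).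
elim: s H => [|t s IH] H; first by exists i0.
have [i iP] := H t (or_introl erefl).
have [j jP] := IH (fun t' t's => H t' (or_intror t's)).
have [k [ki kj]] := le_directed i j.
by exists k => t' [<-|t's] l lk; [apply: iP|apply: (jP t' t's)]; apply: le_trans lk _.
Qed.

(** Saturation applied to the first factor: by directedness finitely many conditions on it follow
    from a single one, which the hypothesis satisfies. *)
Lemma mulset_bigcap (f g : I -> set G') x : monotone_dsets f -> monotone_dsets g ->
  (forall i, mulset (f i) (g i) x) -> mulset (\bigcap_i f i) (\bigcap_i g i) x.
Proof.
move=> [df mf] [dg mg] fgx.
pose P i (v : option unit -> G') := f i (v None) /\ g i ((v None)^-1 * v (Some tt)).
have [||a aP] := @saturation K L S hK unit (fun=> x) (range P) (card_lt_unit hK).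
- by move=> _ [i _ <-]; have dfi := df i; have dgi := dg i; rewrite /P; defi.
- move=> s sP.
  have [i iP] : exists i, forall Q, List.In Q s -> forall v, P i v -> Q v.
    apply: lower_bound => Q /sP[i _ <-]; exists i => j ji v [fj gj].
    by split; [exact: mf fj|exact: mg gj].
  have [a fa [b gb abx]] := fgx i.
  exists a => Q /iP; apply; split => //=.
  by rewrite -abx mulKg.
exists a; first by move=> i _; have [] := aP (P i) (ex_intro2 _ _ i Logic.I erefl).
exists (a^-1 * x); last by rewrite mulVKg.
by move=> i _; have [] := aP (P i) (ex_intro2 _ _ i Logic.I erefl).
Qed.

Definition prodl (s : seq (set G')) : set G' := foldr (@mulset G') [set 1] s.

Lemma prodl_bigcap (s : seq (I -> set G')) x :
  (forall f, List.In f s -> monotone_dsets f) ->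
  (forall i, prodl [seq f i | f <- s] x) -> prodl [seq \bigcap_i f i | f <- s] x.
Proof.
have mono (t : seq (I -> set G')) : (forall f, List.In f t -> monotone_dsets f) ->
    monotone_dsets (fun i => prodl [seq f i | f <- t]).
  elim: t => [|f t IH] ft.
    split=> [i|i j _ //]; rewrite /dset /=; defi.
  have [df mf] := ft f (or_introl erefl).
  have [dt mt] := IH (fun h ht => ft h (or_intror ht)).
  split=> [i|i j ij] /=; first exact: dset_mulset (df i) (dt i).
  exact: mulsetS (mf i j ij) (mt i j ij).
elim: s x => [|f s IH] x fs H /=; first exact: (H i0).
have [a fa [b sb <-]] := mulset_bigcap (fs f (or_introl erefl))
  (mono s (fun h hs => fs h (or_intror hs))) H.
exists a => //; exists b => //.
apply: IH => [h hs|i]; first by apply: fs; right.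
exact: sb.
Qed.

End Directed.

(** Such sets have closed images in S^mu_G(M) ([closed_cls]) and are determined by them
    ([cls_image]), so a measure there gives them a mean. *)
Definition mu_closed Y : Prop := tdset Y /\ forall m y, mu S m -> Y y -> Y (m * y).

Lemma mu_closedI Y Z : mu_closed Y -> mu_closed Z -> mu_closed (Y `&` Z).
Proof.
move=> [tY mY] [tZ mZ]; split=> [x H|m y mm [Yy Zy]]; last by split; [exact: mY|exact: mZ].
by split; [apply: tY|apply: tZ] => D dD AD; apply: H => // y [? ?]; exact: AD.
Qed.

Lemma mu_closedU Y Z : mu_closed Y -> mu_closed Z -> mu_closed (Y `|` Z).
Proof.
move=> [tY mY] [tZ mZ]; split=> [x H|m y mm [?|?]]; last 2 first.
- by left; exact: mY.
- by right; exact: mZ.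
have [Yx|nY] := pselect (Y x); [by left|right].
have [D [dD YD Dx]] : exists D, [/\ dset D, Y `<=` D & ~ D x].
  apply: contrapT => nD; apply: nY; apply: tY => D dD YD.
  by apply: contrapT => Dx; apply: nD; exists D.
apply: tZ => D' dD' ZD'.
have [| |//|//] := H (D `|` D'); first exact: definable_or.
by move=> y [/YD|/ZD']; [left|right].
Qed.

Lemma mu_closedT : mu_closed setT.
Proof. by []. Qed.

Lemma mu_closed0 : mu_closed set0.
Proof. by split=> // x; apply => //; exact: definable_False. Qed.

Hypothesis basis : definable_basis S.

Lemma mu_closed_trans (g : G) Y : mu_closed Y -> mu_closed (trans (incl g) Y).
Proof.
move=> [tY mY]; split=> [x H|m y mm Yy]; last first.
  have := mY _ _ (mu_conj_incl g^-1 mm) Yy.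
  by rewrite /trans /= inclV invgK !mulgA mulgK.
apply: tY => D dD YD.
by apply: (H (trans (incl g) D) (dset_trans g dD)) => y /YD.
Qed.

(* The pairs of a definable neighbourhood of 1 and a definable set containing
   [F]; they shrink to [mu S] and to the type-definable closure of [F]. *)
Section NbhsPairs.
Variable F : set G'.

Definition nbpair : Type := {i : set G' * set G' | mnbhs i.1 /\ (dset i.2 /\ F `<=` i.2)}.
Definition nbpair_le (i j : nbpair) : Prop :=
  (sval i).1 `<=` (sval j).1 /\ (sval i).2 `<=` (sval j).2.
Definition nbpair1 (i : nbpair) : set G' := (sval i).1.
Definition nbpair2 (i : nbpair) : set G' := (sval i).2.

Lemma nbpairT_subproof : mnbhs [set: G'] /\ (dset [set: G'] /\ F `<=` [set: G']).
Proof. by split; [exact: mnbhsT|split => //; exact: definable_True]. Qed.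

Definition nbpairT : nbpair := exist _ (setT, setT) nbpairT_subproof.

Lemma nbpair_le_refl i : nbpair_le i i. Proof. by split. Qed.

Lemma nbpair_le_trans i j k : nbpair_le i j -> nbpair_le j k -> nbpair_le i k.
Proof.
by move=> [ij1 ij2] [jk1 jk2]; split; [exact: subset_trans jk1|exact: subset_trans jk2].
Qed.

Lemma nbpair_directed i j : exists k, nbpair_le k i /\ nbpair_le k j.
Proof.
have kP : mnbhs (nbpair1 i `&` nbpair1 j) /\
    (dset (nbpair2 i `&` nbpair2 j) /\ F `<=` nbpair2 i `&` nbpair2 j).
  have [ni [di ai]] := svalP i; have [nj [dj aj]] := svalP j.
  split; [exact: mnbhsI|split; [exact: definable_and|]].
  by move=> x Fx; split; [exact: ai|exact: aj].
by exists (exist _ (_, _) kP); split; split=> x [].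
Qed.

Lemma monotone_nbpair1 : monotone_dsets nbpair_le nbpair1.
Proof. by split=> [[i [[]]]//|i j []]. Qed.

Lemma monotone_nbpair2 : monotone_dsets nbpair_le nbpair2.
Proof. by split=> [[i [_ []]]//|i j []]. Qed.

Lemma bigcap_nbpair1 : \bigcap_i nbpair1 i = mu S.
Proof.
apply/seteqP; split=> x H; last by move=> [i [ni ?]] _; exact: (mu_sub ni).
by apply/muP => D nD; exact: (H (exist _ (D, setT) (conj nD nbpairT_subproof.2))).
Qed.

Lemma bigcap_nbpair2 :
  \bigcap_i nbpair2 i = [set x | forall D, dset D -> F `<=` D -> D x].
Proof.
apply/seteqP; split=> x H.
  move=> D dD Da.
  exact: (H (exist _ (setT, D) (conj nbpairT_subproof.1 (conj dD Da)))).
by move=> [i [ni [di ai]]] _; exact: H.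
Qed.

Lemma mulset_nbpair (f g : nbpair -> set G') x :
  monotone_dsets nbpair_le f -> monotone_dsets nbpair_le g ->
  (forall i, mulset (f i) (g i) x) -> mulset (\bigcap_i f i) (\bigcap_i g i) x.
Proof.
exact: (mulset_bigcap nbpairT nbpair_le_refl nbpair_directed nbpair_le_trans).
Qed.

Lemma prodl_nbpair (s : seq (nbpair -> set G')) x :
  (forall f, List.In f s -> monotone_dsets nbpair_le f) ->
  (forall i, prodl [seq f i | f <- s] x) -> prodl [seq \bigcap_i f i | f <- s] x.
Proof.
exact: (prodl_bigcap nbpairT nbpair_le_refl nbpair_directed nbpair_le_trans).
Qed.

End NbhsPairs.

Lemma mulset_muM (A : set G') m y : mu S m -> mulset (mu S) A y -> mulset (mu S) A (m * y).
Proof.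
have [m1 mM mV] := subgroup_mu basis.
by move=> mm [a ma [b Ab <-]]; exists (m * a); [exact: mM|exists b; rewrite ?mulgA].
Qed.

Lemma same_type1 (a : G') :
  [set x | same_type a x] = [set x | forall D, dset D -> [set a] `<=` D -> D x].
Proof.
apply/seteqP; split=> x ax D dD aD; apply: ax => //; first exact: aD.
by move=> _ ->.
Qed.

Lemma mulset_mu_tdset (F : set G') x : tdset F ->
  (forall V D, mnbhs V -> dset D -> F `<=` D -> mulset V D x) -> mulset (mu S) F x.
Proof.
move=> tF H.
have := @mulset_nbpair F _ _ x (@monotone_nbpair1 F) (@monotone_nbpair2 F).
have -> : \bigcap_i (@nbpair2 F) i = F.
  by rewrite bigcap_nbpair2; apply/seteqP; split=> y Fy; [exact: tF|move=> D _; exact].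
by rewrite bigcap_nbpair1; apply=> i; have [nV [dD FD]] := svalP i; exact: H.
Qed.

Lemma tdset_mulset_mu (F : set G') : tdset F -> tdset (mulset (mu S) F).
Proof.
move=> tF x H; apply: mulset_mu_tdset => // V D nV dD FD; apply: H.
  exact: dset_mulset nV.1 dD.
by apply: mulsetS => //; exact: mu_sub.
Qed.

Lemma mu_closed_mulset (B : set G') : dset B -> mu_closed (mulset (mu S) B).
Proof.
move=> dB; split=> [|m y]; last exact: mulset_muM.
by apply: tdset_mulset_mu; exact: dset_tdset.
Qed.

Lemma mu_closed_type (a : G') : mu_closed (mulset (mu S) [set x | same_type a x]).
Proof.
split=> [|m y]; last exact: mulset_muM.
apply: tdset_mulset_mu => x H D dD Da; apply: (H D dD) => y; exact.
Qed.

End TypeDefinable.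

(** * The Massicot-Wagner argument *)

Section MassicotWagner.
Variables (R : realType) (K : Type) (L : signature) (S : defGroup L).
Hypothesis hK : monster K S.
Hypothesis basis : definable_basis S.
Local Notation G := (GM S).
Local Notation G' := (GMstar S).
Local Notation N := (@Ntydiff L S).
Implicit Types A B C D X Y Z : set G'.

(** Only values at mu-closed sets are constrained. These sets are stable under unions and
    intersections but in general not under complements, hence modularity in place of additivity. *)
Variable rho : set G' -> R.
Local Open Scope ring_scope.
Hypothesis rho0 : rho set0 = 0.
Hypothesis rhoT : rho setT = 1.
Hypothesis rho_mono : forall Y Z, mu_closed Y -> mu_closed Z -> Y `<=` Z -> rho Y <= rho Z.
Hypothesis rho_mod : forall Y Z, mu_closed Y -> mu_closed Z ->
  rho (Y `|` Z) + rho (Y `&` Z) = rho Y + rho Z.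
Hypothesis rho_trans : forall (g : G) Y, mu_closed Y -> rho (trans (incl g) Y) = rho Y.

Lemma rho_ge0 Y : mu_closed Y -> 0 <= rho Y.
Proof. by move=> cY; rewrite -rho0; apply: rho_mono => //; exact: mu_closed0. Qed.

Lemma rho_le1 Y : mu_closed Y -> rho Y <= 1.
Proof. by move=> cY; rewrite -rhoT; apply: rho_mono => //; exact: mu_closedT. Qed.

Lemma rho_nonempty Y : 0 < rho Y -> exists y, Y y.
Proof.
move=> Y0; apply: contrapT => nY; move: Y0; rewrite (_ : Y = set0) ?rho0 ?ltxx //.
by apply/seteqP; split=> // y Yy; apply: nY; exists y.
Qed.

Lemma rho_pigeonhole (t : R) : 0 < t -> exists M (t' : R), 0 < t' /\
  forall Y : 'I_M -> set G', (forall i, mu_closed (Y i) /\ t <= rho (Y i)) ->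
    exists i j : 'I_M, (i < j)%N /\ t' <= rho (Y i `&` Y j).
Proof.
move=> t0.
(* The constants give [M * t > 2] and [M * e = t / 2]. If all pairwise intersections had mean at
   most [e], each further set would add at least [t / 2] to the union, whose mean would end above
   1. *)
pose M := (Num.trunc (2 / t)).+1.
have M2 : 2 < M%:R * t.
  by rewrite -ltr_pdivrMr //; exact: Num.Theory.truncnS_gt.
have M0 : 0 < M%:R :> R by rewrite ltr0n.
have [e [e0 eM]] : exists e : R, 0 < e /\ M%:R * e = t / 2.
  by exists (t / (2 * M%:R)); split; [rewrite divr_gt0 // mulr_gt0|field; lra].
exists M, e; split => //.
move=> Y HY; apply: contrapT => nE.
have small (i j : 'I_M) : (i < j)%N -> rho (Y i `&` Y j) <= e.
  move=> ij; rewrite leNgt; apply/negP => H; apply: nE.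
  by exists i, j; split => //; exact: ltW.
pose U (k : nat) : set G' := [set y | exists i : 'I_M, (i < k)%N /\ Y i y].
have U0 : U 0%N = set0 by apply/seteqP; split=> y // [i []].
have US k (kM : (k < M)%N) : U k.+1 = U k `|` Y (Ordinal kM).
  apply/seteqP; split=> y.
    move=> [i [ik Yiy]]; move: ik; rewrite ltnS leq_eqVlt => /orP[/eqP ik|ik].
      by right; have -> : Ordinal kM = i by exact/val_inj.
    by left; exists i.
  move=> [[i [ik Yiy]]|Yy]; first by exists i; split => //; exact: ltnW.
  by exists (Ordinal kM).
have cU k : (k <= M)%N -> mu_closed (U k).
  elim: k => [|k IH] kM; first by rewrite U0; exact: mu_closed0.
  by rewrite US; apply: mu_closedU; [exact: IH (ltnW kM)|case: (HY (Ordinal kM))].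
have UI (k : nat) (j : 'I_M) : (k <= j)%N -> rho (U k `&` Y j) <= k%:R * e.
  elim: k => [|k IH] kj; first by rewrite U0 set0I rho0 mul0r.
  have kM : (k < M)%N by exact: leq_ltn_trans (ltnW kj) (ltn_ord j).
  have [cYk _] := HY (Ordinal kM); have [cYj _] := HY j.
  have cUY := mu_closedI (cU k (ltnW kM)) cYj; have c1 := mu_closedI cYk cYj.
  have rU := IH (ltnW kj).
  rewrite US setIUl; have := rho_mod cUY c1; have := rho_ge0 (mu_closedI cUY c1).
  have := @small (Ordinal kM) j kj.
  rewrite -[k.+1%:R]natr1 mulrDl mul1r; move: rU; set a := rho _; set b := rho _; set c := rho _.
  set d := rho _; set f := _ * _; lra.
have big k : (k <= M)%N -> k%:R * (t / 2) <= rho (U k).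
  elim: k => [|k IH] kM; first by rewrite U0 rho0 mul0r.
  have rU := IH (ltnW kM); have [cYk tY] := HY (Ordinal kM).
  have rI := UI k (Ordinal kM) (leqnn k).
  rewrite US; have := rho_mod (cU k (ltnW kM)) cYk.
  have kt : k%:R * e <= t / 2 by rewrite -eM ler_pM2r // ler_nat ltnW.
  rewrite -[k.+1%:R]natr1 mulrDl mul1r; move: rU rI kt tY.
  set a := rho _; set b := rho _; set c := rho _; set d := rho _; lra.
have := le_trans (big M (leqnn M)) (rho_le1 (cU M (leqnn M))).
by rewrite leNgt mulrA ltr_pdivlMr ?mul1r ?M2.
Qed.

Lemma rho_largeM (n : nat) (t : R) : 0 < t -> exists s, size s = n /\
  forall Y, mu_closed Y -> t <= rho Y -> largeM s Y.
Proof.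
elim: n t => [|n IH] t t0.
  by exists [::]; split => // Y cY tY; apply: rho_nonempty; exact: lt_le_trans tY.
have [M [t' [t'0 pig]]] := rho_pigeonhole t0.
have [s [sn sP]] := IH t' t'0.
exists (M :: s); split; first by rewrite /= sn.
move=> Y cY tY x.
have cT i := mu_closed_trans (x i) cY.
have [|i [j [ij H]]] := pig (fun i => trans (incl (x i)) Y).
  by move=> i; split; [exact: cT|rewrite rho_trans].
by exists i, j; split => //; apply: sP => //; exact: mu_closedI.
Qed.

(* Otherwise [v] decreases by [eps] at each step down the list [s]. *)
Lemma large_descent (eps : R) (v : set G' -> R) (X : set G') s B :
  (forall C, dset C -> 0 <= v C) -> dset B -> B `<=` X -> large s B ->
  v B < (size s)%:R * eps ->
  exists M s' B', [/\ dset B', B' `<=` X, large (M :: s') B' &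
    forall C, dset C -> C `<=` B' -> large s' C -> v B' <= v C + eps].
Proof.
move=> v0; elim: s B => [|M s IH] B dB BX BL vB.
  by have := v0 B dB; move: vB; rewrite mul0r => /lt_le_trans /[apply]; rewrite ltxx.
have [H|/existsNP[C /not_implyP[dC /not_implyP[CB /not_implyP[CL /negP]]]]] :=
    pselect (forall C, dset C -> C `<=` B -> large s C -> v B <= v C + eps).
  by exists M, s, B.
rewrite -ltNge => vC; apply: (IH C) => //; first exact: subset_trans BX.
move: vB; rewrite -[(size (M :: s))%:R]natr1 mulrDl mul1r; move: vC; set a := v C; set b := v B.
set c := _ * _; lra.
Qed.

Section NearStabilizer.
Variable Y : set G'.
Hypothesis cY : mu_closed Y.

Definition near_stab (d : R) (g : G) : Prop := rho Y - d <= rho (Y `&` trans (incl g) Y).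

Lemma near_stabV d g : near_stab d g -> near_stab d (g^-1)%g.
Proof.
rewrite /near_stab => H; apply: (le_trans H).
rewrite -[X in _ <= X](rho_trans g); last by apply: mu_closedI => //; exact: mu_closed_trans.
rewrite le_eqVlt; apply/orP; left; apply/eqP; congr rho.
have -> A B : trans (incl g) (A `&` B) = trans (incl g) A `&` trans (incl g) B by [].
by rewrite transM inclV mulgV trans1 setIC.
Qed.

(** Y cap gY and gY cap ghY both lie in gY; by modularity their common part, which is inside Y cap
    ghY, misses at most the sum of the two defects. *)
Lemma near_stabM d e g h : near_stab d g -> near_stab e h -> near_stab (d + e) (g * h)%g.
Proof.
rewrite /near_stab => gd he.
have cg := mu_closed_trans g cY; have cgh := mu_closed_trans (g * h)%g cY.
have ch := mu_closed_trans h cY.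
have E : rho (trans (incl g) Y `&` trans (incl (g * h)%g) Y) = rho (Y `&` trans (incl h) Y).
  rewrite -[RHS](rho_trans g); last exact: mu_closedI.
  by rewrite inclM -transM.
have c1 := mu_closedI cY cg; have c2 := mu_closedI cg cgh.
have H1 : rho ((Y `&` trans (incl g) Y) `|` (trans (incl g) Y `&` trans (incl (g * h)%g) Y))
    <= rho (trans (incl g) Y).
  by apply: rho_mono => //; [exact: mu_closedU|move=> y [[]|[]]].
have H2 : rho ((Y `&` trans (incl g) Y) `&` (trans (incl g) Y `&` trans (incl (g * h)%g) Y))
    <= rho (Y `&` trans (incl (g * h)%g) Y).
  by apply: rho_mono; [exact: mu_closedI|exact: mu_closedI|move=> y [[? ?] [? ?]]].
have := rho_mod c1 c2; rewrite E; move: H1 H2 gd he; rewrite rho_trans //.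
set a := rho _; set b := rho _; set c := rho _; set i := rho _; set f := rho _.
set k := rho _; lra.
Qed.

End NearStabilizer.

(** The translates are by elements of G(M), so two elements of the same type lie in a common one,
    and its [x j] cancels in their quotient. *)
Lemma tydiff_sub_generic m (x : 'I_m -> G) D : dset D ->
  (forall y, exists j : 'I_m, D ((incl (x j))^-1 * y)%g) ->
  @tydiff L S `<=` mulset (invset D) D.
Proof.
move=> dD xD _ [a [b [ab ->]]]; have [j Da] := xD a.
have Db : D ((incl (x j))^-1 * b)%g.
  by apply: (ab (fun y => D ((incl (x j))^-1 * y)%g)) Da; rewrite -inclV /dset; defi.
exists ((incl (x j))^-1 * a)^-1%g; first by rewrite /invset /= invgK.
by exists ((incl (x j))^-1 * b)%g => //; rewrite invgM invgK mulgA mulgK.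
Qed.

Lemma dset_powset D k : dset D -> dset (powset D k).
Proof.
move=> dD; elim: k => [|k IH] /=; last exact: dset_mulset.
by rewrite /dset /=; defi.
Qed.

Lemma powsetS A B k : A `<=` B -> powset A k `<=` powset B k.
Proof. by move=> AB; elim: k => //= k IH; exact: mulsetS. Qed.

(** Each factor from D^-1 D costs twice the defect [d]. The defect is known only at points of G(M),
    so a factorization of [g] in G(Mstar) is first replaced by one in G(M). *)
Lemma near_stab_powset Y D (d : R) k : mu_closed Y -> dset D ->
  (forall g, D (incl g) -> near_stab Y d g) ->
  forall g : G, powset (mulset (invset D) D) k (incl g) -> near_stab Y (k%:R * (d + d)) g.
Proof.
move=> cY dD HD; elim: k => [|k IH] g.
  by rewrite /near_stab /= => ->; rewrite trans1 setIid mul0r subr0.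
have dP := dset_powset k (dset_mulset (dset_invset dD) dD).
move=> [x Px [_ [y Dy [z Dz <-]] xyz]].
have [||v [Pv [Dv [Dv' vE]]]] := @transfer_tuple L S 3 (fun v =>
   powset (mulset (invset D) D) k (v (inord 0)) /\ D (v (inord 1))^-1%g /\ D (v (inord 2)) /\
   v (inord 0) * (v (inord 1) * v (inord 2)) = incl g)%g.
- by defi.
- exists (fun i : 'I_3 => if i == inord 0 then x else if i == inord 1 then y else z).
  have E (i j : nat) : (i < 3)%N -> (j < 3)%N -> (inord i == inord j :> 'I_3) = (i == j).
    by move=> i3 j3; rewrite -val_eqE /= !inordK.
  by rewrite !E.
have gE : incl g = incl (v (inord 0%N) * ((v (inord 1%N))^-1^-1 * v (inord 2%N)))%g.
  by rewrite invgK !inclM vE.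
have -> : k.+1%:R * (d + d) = k%:R * (d + d) + (d + d) by rewrite -natr1 mulrDl mul1r.
rewrite /near_stab gE; apply: near_stabM => //; first exact: IH.
apply: near_stabM => //; last exact: HD.
by apply: near_stabV => //; apply: HD; rewrite inclV.
Qed.

Lemma prodl_cons A (s : seq (set G')) x y : A x -> prodl s y -> prodl (A :: s) (x * y)%g.
Proof. by move=> Ax sy; exists x => //; exists y. Qed.

(** A point [g] of G(M) that is a product of [k] elements of D^-1 D moves Y too little to make it
    disjoint from itself, so [g] is in Y Y^-1. Both (D^-1 D)^k and the right-hand side are
    definable, so checking points of G(M) is enough. *)
Lemma powset_tydiff_sub V X k : mnbhs V -> dset X -> 0 < rho (mulset (mu S) X) ->
  powset (@tydiff L S) k `<=`
    prodl [:: V; V; X; invset X; X; invset X; X; invset X; invset V; invset V].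
Proof.
move=> nV dX; set t := rho _ => t0.
have [m1 mM mV] := subgroup_mu basis.
have dV := nV.1; have dXi := dset_invset dX.
(* Products of [k] elements of D^-1 D lose at most 2 k eps, which must stay below [t]; the added 1
   makes the inequality strict and covers [k = 0]. *)
have [eps [eps0 epsE]] : exists eps : R, 0 < eps /\ k%:R * (eps + eps) < t.
  have k0 : 0 < 2 * k%:R + 1 :> R by have : 0 <= k%:R :> R by []; lra.
  exists (t / (2 * k%:R + 1)); split; first exact: divr_gt0.
  have -> : k%:R * (t / (2 * k%:R + 1) + t / (2 * k%:R + 1)) = t * (2 * k%:R / (2 * k%:R + 1)).
    by field; lra.
  by rewrite gtr_pMr // ltr_pdivrMr // mul1r ltrDl.
(* Means are at most 1, so [n] successive losses of [eps] are impossible and the descent stops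
   within a list of length [n]. *)
pose n := (Num.trunc (1 / eps)).+1.
have n1 : 1 < n%:R * eps by rewrite -ltr_pdivrMr //; exact: Num.Theory.truncnS_gt.
pose Z := mulset (invset X) X.
have dZ : dset Z by exact: dset_mulset.
have cX := mu_closed_mulset hK basis dX.
have [s [sn sP]] := rho_largeM n t0.
have largeVX : large s (mulset V X).
  apply: (large_of_largeM (dset_mulset dV dX) _ (sP _ cX (lexx _))).
  by apply: mulsetS => //; exact: mu_sub.
pose v B := rho (mulset (mu S) (mulset B Z)).
have cB B : dset B -> mu_closed (mulset (mu S) (mulset B Z)).
  by move=> dB; apply: (mu_closed_mulset hK basis); exact: dset_mulset.
have [|||||M [s' [B [dB BVX BL Bmin]]]] := @large_descent eps v (mulset V X) s (mulset V X).
- by move=> C dC; apply: rho_ge0; exact: cB.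
- exact: dset_mulset.
- by [].
- exact: largeVX.
- by apply: le_lt_trans (rho_le1 (cB _ (dset_mulset dV dX))) _; rewrite sn.
pose D := [set g | large s' (trans g B `&` B)].
have dD : dset D.
  apply: (@large_definable _ _ s' _ (fun y v => B ((v tt)^-1 * y)%g /\ B y)).
  by defi.
have [m [x xD]] := large_generic dB BL.
set Y := mulset (mu S) (mulset B Z).
have cY : mu_closed Y by exact: cB.
(* For C = gB cap B near-minimality gives [v B <= v C + eps], and mu C Z lies in both Y and gY since
   [g] normalizes [mu]. *)
have DY g : D (incl g) -> near_stab Y eps g.
  move=> Dg; have dC : dset (trans (incl g) B `&` B).
    by apply: definable_and => //; exact: dset_trans.
  have := Bmin _ dC (@subIsetr _ _ _) Dg; rewrite /near_stab -/(v B) lerBlDr => H.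
  apply: le_trans H _; rewrite lerD2r; apply: rho_mono.
  - exact: cB.
  - by apply: mu_closedI => //; exact: mu_closed_trans.
  move=> _ [n' mn' [_ [c [Bc1 Bc2] [z Zz <-]] <-]]; split.
    by exists n' => //; exists (c * z)%g => //; exists c => //; exists z.
  rewrite /trans /=; exists ((incl g)^-1 * n' * incl g)%g.
    by have := mu_conj_incl g^-1%g mn'; rewrite inclV invgK.
  exists ((incl g)^-1 * c * z)%g; last by rewrite !mulgA mulgK.
  by exists ((incl g)^-1 * c)%g => //; exists z.
(* For [g] in B and [h] in X, Y contains the translate of mu X by g h^-1, because Z contains h^-1 X.
   Both points are taken in G(M), whose translations preserve [rho]. *)
have tY : t <= rho Y.
  have [b Bb] := large_nonempty BL.
  have [g Bg] := transfer1 dB (ex_intro _ b Bb).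
  have [_ [_ _ [x0 Xx0 _]]] := rho_nonempty t0.
  have [h Xh] := transfer1 dX (ex_intro _ x0 Xx0).
  rewrite /t -(rho_trans (g * h^-1)%g cX); apply: rho_mono => //.
    exact: mu_closed_trans.
  move=> y [n' mn' [x1 Xx1 yE]].
  have {}yE : y = (incl (g * h^-1) * n' * x1)%g by rewrite -mulgA yE mulVKg.
  exists (incl (g * h^-1) * n' * (incl (g * h^-1))^-1)%g; first exact: mu_conj_incl.
  exists (incl (g * h^-1) * x1)%g; last by rewrite yE !mulgA mulgVK.
  exists (incl g) => //; exists ((incl h)^-1 * x1)%g; last by rewrite inclM inclV mulgA.
  by exists (incl h)^-1%g; [rewrite /invset /= invgK|exists x1].
apply: (subset_trans (powsetS (tydiff_sub_generic dD (x := x) _))).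
  by move=> y; exact: xD.
apply: transfer_sub.
- by apply: dset_powset; apply: dset_mulset => //; exact: dset_invset.
- rewrite /prodl /=; do !apply: dset_mulset => //; try exact: dset_invset.
  by rewrite /dset /=; defi.
move=> g /(near_stab_powset cY dD DY); rewrite /near_stab => H.
have [|y []] := @rho_nonempty (Y `&` trans (incl g) Y).
  by apply: lt_le_trans H; rewrite subr_gt0; exact: lt_le_trans tY.
have YE y' : Y y' -> exists m' v' x1 x2 x3, [/\ mu S m', V v', X x1 /\ X x2, X x3 &
    y' = m' * v' * x1 * x2^-1 * x3]%g.
  move=> [m' mm' [_ [_ /BVX[v' Vv' [x1 Xx1 <-]] [_ [x2 Xx2 [x3 Xx3 <-]] <-]] <-]].
  by exists m', v', x1, x2^-1%g, x3; split => //; rewrite invgK !mulgA.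
move=> /YE[a [v1 [x1 [x2 [x3 [ma Vv1 [Xx1 Xx2] Xx3 yE]]]]]].
move=> /YE[b [v2 [y1 [y2 [y3 [mb Vv2 [Xy1 Xy2] Xy3 gyE]]]]]].
(* [g] is y times the inverse of g^-1 y, each factored in mu V X X^-1 X; V and V^-1 absorb the
   infinitesimals [a] and [b^-1]. *)
have -> : incl g = (a * (v1 * (x1 * (x2^-1 * (x3 * (y3^-1 * (y2 * (y1^-1 * (v2^-1 * (b^-1 * 1))))))))))%g.
  have -> : incl g = (y * ((incl g)^-1 * y)^-1)%g by rewrite invgM invgK mulVKg.
  by rewrite gyE yE !invgM invgK !mulgA mulg1.
have I A z : A z -> invset A z^-1%g by rewrite /invset /= invgK.
have mVa : V a by exact: mu_sub ma.
have mVb : V b by exact: mu_sub mb.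
by do 10![apply: prodl_cons; first by auto].
Qed.

Lemma mulset_mu_setT : mulset (mu S) setT = setT.
Proof.
have [m1 _ _] := subgroup_mu basis.
by apply/seteqP; split=> // x _; exists 1%g => //; exists x; rewrite ?mul1g.
Qed.

(** The definable X with mu X of mean 0 form an ideal, proper because [rho setT] is 1; by saturation
    some point avoids them all. *)
Lemma wide_point : exists a, forall X, dset X -> X a -> 0 < rho (mulset (mu S) X).
Proof.
pose null X := dset X /\ rho (mulset (mu S) X) <= 0.
have nullU X Y : null X -> null Y -> null (X `|` Y).
  move=> [dX X0] [dY Y0]; split; first exact: definable_or.
  have cX := mu_closed_mulset hK basis dX; have cY := mu_closed_mulset hK basis dY.
  have -> : mulset (mu S) (X `|` Y) = mulset (mu S) X `|` mulset (mu S) Y.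
    apply/seteqP; split=> x.
      by move=> [m mm [y [Xy|Yy] <-]]; [left|right]; exists m => //; exists y.
    by move=> [|] [m mm [y Hy <-]]; exists m => //; exists y => //; [left|right].
  have := rho_mod cX cY; have := rho_ge0 (mu_closedI cX cY); move: X0 Y0.
  set a := rho _; set b := rho _; set c := rho _; set d := rho _; lra.
have [||a aP] := saturation_dsets hK (F := [set D | null (~` D)]).
- by move=> D [dD _]; rewrite -[D]setCK; exact: dset_setC.
- move=> s sP.
  have [X [[dX X0] Xs]] : exists X, null X /\ forall x, ~ X x ->
      forall D, List.In D s -> D x.
    elim: s sP => [|D s IH] sP.
      exists set0; split=> //; split; first exact: definable_False.
      by rewrite (_ : mulset _ _ = set0) ?rho0 //; apply/seteqP; split=> // x [m _ []].
    have [X [nX Xs]] := IH (fun Q Qs => sP Q (or_intror Qs)).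
    exists (X `|` ~` D); split; first exact: nullU nX (sP D (or_introl erefl)).
    move=> x nXD E [<-|Es]; first by apply: contrapT => nD; apply: nXD; right.
    by apply: Xs => // Xx; apply: nXD; left.
  apply: contrapT => nE.
  have XT : X = setT.
    apply/seteqP; split=> // x _; apply: contrapT => nX.
    by apply: nE; exists x; exact: Xs.
  by move: X0; rewrite XT mulset_mu_setT rhoT ler10.
exists a => X dX Xa; rewrite ltNge; apply/negP => X0.
by have := aP (~` X); rewrite /= setCK; apply.
Qed.

(** An element of all the products factors, by saturation, with entries simultaneously in [mu] and
    among realizations of the type of [a] and their inverses; a quotient x y^-1 of two realizations
    lies in [N]. The eleventh factor, one more V, takes in the mu of mu N. *)
Lemma muN_type_definable : M_type_definable (mulset (mu S) N).
Proof.
have [a aW] := wide_point.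
have [mN1 mNM mNV] := subgroup_muN hK basis.
have [N1 NM NV] := subgroup_Ntydiff S; have [m1 mM mV] := subgroup_mu basis.
pose fV := @nbpair1 L S [set a]; pose fX := @nbpair2 L S [set a].
pose fVi i := invset (fV i); pose fXi i := invset (fX i).
pose FW := [:: fV; fV; fV; fX; fXi; fX; fXi; fX; fXi; fVi; fVi].
have mV' : monotone_dsets (@nbpair_le L S [set a]) fV by exact: monotone_nbpair1.
have mX' : monotone_dsets (@nbpair_le L S [set a]) fX by exact: monotone_nbpair2.
have mVi : monotone_dsets (@nbpair_le L S [set a]) fVi.
  by split=> [i|i j [ij _] x]; [apply: dset_invset; exact: mV'.1|exact: ij].
have mXi : monotone_dsets (@nbpair_le L S [set a]) fXi.
  by split=> [i|i j [_ ij] x]; [apply: dset_invset; exact: mX'.1|exact: ij].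
have dW i : dset (prodl [seq f i | f <- FW]).
  rewrite /prodl /=; do 11![apply: dset_mulset; first by [exact: mV'.1|exact: mX'.1|exact: mVi.1|exact: mXi.1]].
  by rewrite /dset /=; defi.
suff WE : mulset (mu S) N = \bigcap_i prodl [seq f i | f <- FW].
  exists [set phi | exists i, defMstar phi = prodl [seq f i | f <- FW]].
  rewrite WE; apply/seteqP; split=> x H.
    by move=> phi [i ->]; exact: H.
  by move=> i _; have [phi phiE] := dsetP (dW i); rewrite phiE; apply: H; exists i.
apply/seteqP; split=> x.
  move=> [m mm [y Ny <-]] i _; have [nV [dX /(_ a erefl) Xa]] := svalP i.
  have [k _ ky] := smallest_powset (@tydiffV L S) Ny.
  apply: prodl_cons; first exact: mu_sub mm.
  exact: (powset_tydiff_sub nV dX (aW _ dX Xa) ky).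
move=> H; have {H} : prodl [seq \bigcap_i f i | f <- FW] x.
  apply: (prodl_nbpair hK); last by move=> i; exact: H.
  by move=> f /=; do 11?[case=> [<- //|]].
have bV y : (\bigcap_i fV i) y -> mu S y by rewrite (bigcap_nbpair1 [set a]).
have bX y : (\bigcap_i fX i) y -> same_type a y by rewrite (bigcap_nbpair2 [set a]) -same_type1.
have bVi y : (\bigcap_i fVi i) y -> mu S y.
  by move=> Hy; have /mV := bV y^-1%g Hy; rewrite invgK.
have bXi y : (\bigcap_i fXi i) y -> same_type a y^-1%g by move=> Hy; exact: bX.
have NX y z : (\bigcap_i fX i) y -> (\bigcap_i fXi i) z -> N (y * z)%g.
  move=> /bX ay /bXi az; rewrite -[z]invgK; apply: tydiff_Ntydiff; apply: tydiff_right.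
  exact: same_type_trans (same_type_sym ay) az.
have mN y : mu S y -> mulset (mu S) N y by move=> my; exists y => //; exists 1%g; rewrite ?mulg1.
have nN y : N y -> mulset (mu S) N y by move=> Ny; exists 1%g => //; exists y; rewrite ?mul1g.
move=> [v1 /bV/mN h1 [_ [v2 /bV/mN h2 [_ [v3 /bV/mN h3 [_ [x1 hx1 [_ [y1 hy1 [_ [x2 hx2 [_ [y2 hy2
  [_ [x3 hx3 [_ [y3 hy3 [_ [w1 /bVi/mN k1 [_ [w2 /bVi/mN k2 [_ -> <-]] <-]] <-]] <-]] <-]] <-]]
  <-]] <-]] <-]] <-]] <-]].
have n1 := nN _ (NX _ _ hx1 hy1); have n2 := nN _ (NX _ _ hx2 hy2).
have n3 := nN _ (NX _ _ hx3 hy3).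
have := mNM _ _ h1 (mNM _ _ h2 (mNM _ _ h3 (mNM _ _ n1 (mNM _ _ n2 (mNM _ _ n3 (mNM _ _ k1 k2)))))).
by rewrite !mulgA mulg1.
Qed.

Lemma mean_components_eq : G00_top K S = G000_top K S.
Proof.
by apply: (G00_top_eq_of_sub hK basis); apply: (G00_sub_muN hK basis); exact: muN_type_definable.
Qed.

End MassicotWagner.

(** * The space of mu-types *)

Section MuTypes.
Variables (K : Type) (L : signature) (S : defGroup L).
Hypothesis hK : monster K S.
Hypothesis basis : definable_basis S.
Local Notation G := (GM S).
Local Notation G' := (GMstar S).
Implicit Types A B C D X Y : set G'.
Local Open Scope quotient_scope.

Lemma gtype_inj : injective (@gtype_set L S).
Proof.
move=> [p p1 p2 p3] [q q1 q2 q3] /= pq; subst q.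
by congr GType; exact: Prop_irrelevance.
Qed.

Lemma realizations_tp (a b : G') : realizations (tp a) b <-> same_type a b.
Proof.
split=> [H D /dsetP[phi ->] Da|ab phi]; first exact: H.
exact: (ab _ (dset_defMstar phi)).
Qed.

Lemma tp_eq (a b : G') : same_type a b -> tp a = tp b.
Proof.
move=> ab; apply: gtype_inj; apply/seteqP; split=> phi /=.
  exact: (ab _ (dset_defMstar phi)).
exact: (same_type_sym ab (dset_defMstar phi)).
Qed.

Lemma gtype_realized (p : gtype S) : exists a, p = tp a.
Proof.
have [||a aP] := saturation_dsets hK (F := [set D | exists2 phi, gtype_set p phi & D = defMstar phi]).
- by move=> _ [phi _ ->]; exact: dset_defMstar.
- move=> s sP.
  have [t [tp1 tP]] : exists t : seq (Mformula S), (forall phi, List.In phi t -> gtype_set p phi) /\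
      forall D, List.In D s -> exists2 phi, List.In phi t & D = defMstar phi.
    elim: s sP => [|D s IH] sP; first by exists [::].
    have [|t [t1 t2]] := IH; first by move=> ? ?; apply: sP; right.
    have [phi pphi DE] := sP D (or_introl erefl).
    exists (phi :: t); split; first by move=> ? [<-|/t1].
    by move=> _ [<-|/t2[psi ? ->]]; [exists phi|exists psi] => //; [left|right].
  (* The formula of the domain is added so that the realization is an element of the group and not
     just a tuple. *)
  pose F := [set phi | List.In phi (frename inl (domF S) :: t)].
  have Fp : F `<=` gtype_set p.
    by move=> phi [<-|/tp1//]; exact: gtype_conc.
  have finF : finite_set F.
    rewrite /F; elim: (_ :: t) => [|phi u IH] /=.
      by rewrite (_ : mkset _ = set0) //; apply/seteqP; split.
    rewrite (_ : mkset _ = [set phi] `|` [set psi | List.In psi u]).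
      by rewrite finite_setU; split.
    by apply/seteqP; split=> psi [<-|?]; [left|right|left|right].
  have [x xP] := gtype_consistent Fp finF.
  have /sat_rename/sat_domF[a ax] := xP _ (or_introl erefl).
  exists a => _ /tP[phi tphi ->]; rewrite /defMstar /= ax.
  by apply: xP; right.
exists a; apply: gtype_inj; apply/seteqP; split=> phi /=.
  by move=> pphi; apply: (aP (defMstar phi)); exists phi.
move=> aphi; have [//|nphi] := gtype_complete p phi.
have H : defMstar (Neg phi) a by apply: aP; exists (Neg phi).
by case: (H aphi).
Qed.

Lemma open_gtype (phi : Mformula S) : open [set p : gtype S | gtype_set p phi].
Proof.
exists [set [set p : gtype S | gtype_set p phi]]; last first.
  by apply/seteqP; split=> p; [move=> [_ ->]|exists [set p | gtype_set p phi]].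
move=> _ ->; exists (finmap.fset1 [set p : gtype S | gtype_set p phi]).
  by move=> X; rewrite finmap.in_fset1 => /eqP ->; apply/mem_set; exists phi.
apply/seteqP; split=> p H; last by move=> X; rewrite /= finmap.in_fset1 => /eqP ->.
by apply: (H [set q : gtype S | gtype_set q phi]); rewrite /= finmap.in_fset1.
Qed.

Lemma open_gtypeP (U : set (gtype S)) (a : G') : open U -> U (tp a) ->
  exists D, [/\ dset D, D a & forall b, D b -> U (tp b)].
Proof.
move=> [F Ffin <-] [A FA Aa].
have [X Xfin XA] := Ffin A FA.
have [D [dD Da DX]] : exists D, [/\ dset D, D a & forall b, D b ->
    forall Y : set (gtype S), Y \in finmap.enum_fset X -> Y (tp b)].
  have : forall Y : set (gtype S), Y \in finmap.enum_fset X -> Y (tp a) /\ exists phi, Y = [set p | gtype_set p phi].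
    move=> Y YX; split; first by move: Aa; rewrite -XA; apply.
    by have /set_mem[phi _ <-] := Xfin Y YX; exists phi.
  elim: (finmap.enum_fset X) => [|Y s IH] H.
    by exists setT; split => //; exact: definable_True.
  have [D [dD Da Ds]] := IH (fun Z Zs => H Z (mem_behead (s := Y :: s) Zs)).
  have [Ya [phi YE]] := H Y (mem_head _ _).
  exists (defMstar phi `&` D); split.
  - by apply: definable_and => //; exact: dset_defMstar.
  - by split => //; move: Ya; rewrite YE.
  - move=> b [bphi Db] Z; rewrite in_cons => /orP[/eqP ->|]; last exact: Ds.
    by rewrite YE.
exists D; split => // b Db; exists A => //.
suff : (A : set (gtype S)) (tp b) by [].
by rewrite -XA => Y YX; exact: DX Db Y YX.
Qed.

Definition cls (a : G') : Smu S := \pi_(quotient_topology {eq_quot (@mu_equiv L S)}) (tp a).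

(** mu tp(a) is type-definable over M, so together with [b] it contains every realization of the
    type of [b]; cancelling the infinitesimal gives the symmetric inclusion. *)
Lemma cls_eq (a b : G') : cls a = cls b <-> mulset (mu S) [set x | same_type a x] b.
Proof.
have tE (c : G') : realizations (tp c) = [set x | same_type c x].
  by apply/seteqP; split=> x => [/realizations_tp//|?]; exact/realizations_tp.
have [m1 mM mV] := subgroup_mu basis.
have E : cls a = cls b <-> mulset (mu S) (realizations (tp a)) = mulset (mu S) (realizations (tp b)).
  split=> [|ab].
    by move=> /(@eqmodP _ (mu_equiv_canonical S) (tp a) (tp b)) /asboolP.
  by apply/(@eqmodP _ (mu_equiv_canonical S) (tp a) (tp b))/asboolP.
have tdT (c x y : G') : same_type x y -> mulset (mu S) [set x | same_type c x] x ->
    mulset (mu S) [set x | same_type c x] y.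
  move=> xy Hx; apply: (mu_closed_type hK basis c).1 => D dD cD.
  by apply: (xy D dD); exact: cD.
rewrite {}E !tE; split=> [->|]; first by exists 1 => //; exists b; rewrite ?mul1g.
have key (c d : G') : mulset (mu S) [set x | same_type c x] d ->
    mulset (mu S) [set x | same_type d x] `<=` mulset (mu S) [set x | same_type c x].
  move=> cd _ [m mm [d' dd' <-]]; apply: mulset_muM => //.
  exact: tdT dd' cd.
move=> ab; apply/seteqP; split; apply: key => //.
move: ab => [m mm [a1 aa1 <-]]; apply: (@tdT _ a1); first exact: same_type_sym.
by exists m^-1; [exact: mV|exists (m * a1) => //; rewrite mulKg].
Qed.

Lemma cls_surj (x : Smu S) : exists a, x = cls a.
Proof. by have [a pa] := gtype_realized (repr x); exists a; rewrite /cls -pa reprK. Qed.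

Lemma cls_image A : mu_closed A -> forall a : G', (cls @` A) (cls a) <-> A a.
Proof.
move=> [tA mA] a; split=> [[b Ab]|Aa]; last by exists a.
move=> /cls_eq[m mm [b' bb' <-]]; apply: mA => //.
by apply: tA => D dD AD; apply: (bb' D dD); exact: AD.
Qed.

(** The chosen representative and realization agree with [a] up to type over M and an infinitesimal;
    neither matters, since [g] in G(M) normalizes [mu]. *)
Lemma Smu_actE (g : G) (a : G') : Smu_act g (cls a) = cls (incl g * a).
Proof.
rewrite /Smu_act /gtype_act.
have [a' a'E] := gtype_realized (repr (cls a)).
have /esym/cls_eq : cls a' = cls a by rewrite /cls -a'E reprK.
rewrite a'E; set a2 := xget _ _.
have : realizations (tp a') a2 by apply: (@xgetI _ _ _ a'); apply/realizations_tp.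
move=> /realizations_tp a'a2 aa'.
have : cls a = cls a2 by rewrite /cls -(tp_eq a'a2); apply/cls_eq.
move=> /cls_eq[m mm [a1 aa1 a2E]].
apply/esym/cls_eq; exists (incl g * m * (incl g)^-1); first exact: mu_conj_incl.
exists (incl g * a1); last by rewrite -a2E !mulgA mulgVK.
move=> D dD; apply: (aa1 (fun y => D (incl g * y))).
by rewrite /dset; defi.
Qed.

Lemma Smu_act_preimage (g : G) A : mu_closed A ->
  Smu_act g^-1 @^-1` (cls @` A) = cls @` (trans (incl g) A).
Proof.
move=> cA; have cg := mu_closed_trans g cA.
apply/seteqP; split=> x; have [a ->] := cls_surj x.
  by rewrite /preimage /= Smu_actE => /(cls_image cA); rewrite inclV => H; apply/(cls_image cg).
move=> /(cls_image cg) H; rewrite /preimage /= Smu_actE inclV.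
exact/(cls_image cA).
Qed.

Lemma closed_cls A : mu_closed A -> closed (cls @` A).
Proof.
move=> cA; rewrite -openC.
change (open ((\pi_(quotient_topology {eq_quot (@mu_equiv L S)}) : gtype S -> Smu S)
   @^-1` (~` (cls @` A)))).
rewrite openE => p; have [a ->] := gtype_realized p => nAa.
have [D [dD AD Da]] : exists D, [/\ dset D, A `<=` D & ~ D a].
  apply: contrapT => nD; apply: nAa; apply/(cls_image cA); apply: cA.1 => D dD AD.
  by apply: contrapT => Da; apply: nD; exists D.
have [phi DE] := dsetP dD.
rewrite /interior; apply: (@filterS _ _ _ [set q | gtype_set q (Neg phi)]); last first.
  apply: open_nbhs_nbhs; split; first exact: open_gtype.
  by move: Da; rewrite DE.
move=> q; have [b ->] := gtype_realized q => bphi /(cls_image cA)/AD.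
by rewrite DE.
Qed.

Section Mean.
Variables (R : realType) (P : probability (borel (Smu S)) R).
Hypothesis P_inv : forall (g : G) (B : set (borel (Smu S))), measurable B ->
  P (@Smu_act L S g @^-1` B) = P B.

Definition mean (A : set G') : R := fine (P (cls @` A)).

Lemma measurable_cls A : mu_closed A -> measurable (cls @` A : set (borel (Smu S))).
Proof.
move=> cA; rewrite -[X in measurable X]setCK; apply: measurableC.
by apply: sub_sigma_algebra; rewrite openC; exact: closed_cls.
Qed.

Lemma definably_amenable_components_eq : G00_top K S = G000_top K S.
Proof.
apply: (mean_components_eq hK basis (rho := mean)); rewrite /mean.
- by rewrite image_set0 measure0.
- rewrite (_ : cls @` setT = setT) ?probability_setT //.
  by apply/seteqP; split=> // x _; have [a ->] := cls_surj x; exists a.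
- move=> Y Z cY cZ YZ; apply: fine_le; rewrite ?fin_num_measure //; try exact: measurable_cls.
  by apply: le_measure; rewrite ?inE; try exact: measurable_cls; exact: image_subset.
- move=> Y Z cY cZ; have mY := measurable_cls cY; have mZ := measurable_cls cZ.
  (* Images commute with this intersection because a mu-closed set contains every point whose class
     meets it. *)
  have -> : cls @` (Y `&` Z) = cls @` Y `&` cls @` Z.
    apply/seteqP; split=> x.
      by move=> [a [Ya Za] <-]; split; exists a.
    have [a ->] := cls_surj x.
    by move=> [/(cls_image cY) Ya /(cls_image cZ) Za]; exists a.
  rewrite image_setU measureUfinl ?ltey_eq ?fin_num_measure //.
  have fY := fin_num_measure P _ mY; have fZ := fin_num_measure P _ mZ.
  have fI := fin_num_measure P _ (measurableI _ _ mY mZ).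
  by rewrite fineB ?fin_numD ?fY // fineD // GRing.subrK.
- move=> g Y cY; rewrite -(Smu_act_preimage g cY) P_inv //; exact: measurable_cls.
Qed.

End Mean.

End MuTypes.

(** * The flow of mu-types *)

Section SmuFlow.
Variables (K : Type) (L : signature) (S : defGroup L).
Hypothesis hK : monster K S.
Hypothesis basis : definable_basis S.
Local Notation G := (GM S).
Local Notation G' := (GMstar S).
Implicit Types A B C D X Y : set G'.
Local Open Scope quotient_scope.

(** Saturation realizes at once all definable sets whose types form a member of the ultrafilter; the
    ultrafilter converges to the type of the realization. *)
Lemma compact_gtype : compact [set: gtype S].
Proof.
rewrite compact_ultra => F uF _.
pose gD D := [set p : gtype S | exists2 b, p = tp b & D b].
have gDI D D' : dset D -> gD D `&` gD D' `<=` gD (D `&` D').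
  move=> dD p [[b -> Db] [b' bb' D'b']]; exists b' => //; split => //.
  have /realizations_tp b'b : realizations (tp b) b'.
    by rewrite bb'; apply/realizations_tp.
  exact: b'b.
have [||a aP] := saturation_dsets hK (F := [set D | dset D /\ F (gD D)]).
- by move=> D [].
- move=> s sF.
  have : F (gD [set x | forall D, List.In D s -> D x]).
    elim: s sF => [|D s IH] sF.
      by apply: filterS filterT => p _; have [b ->] := gtype_realized hK p; exists b.
    have [dD FD] := sF D (or_introl erefl).
    apply: filterS (filterI FD (IH (fun E Es => sF E (or_intror Es)))).
    apply: subset_trans (gDI _ _ dD) _ => p [b -> [Db sb]]; exists b => // E [<-//|].
    exact: sb.
  by move=> /filter_ex[p [b _ sb]]; exists b.
exists (tp a); split => // U /=; rewrite nbhsE => -[V [oV Va] VU].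
have [D [dD Da DV]] := open_gtypeP oV Va.
apply: (filterS VU).
have [FD|nF] := in_ultra_setVsetC (gD D) uF; first by apply: filterS FD => _ [b -> /DV].
have [] : (~` D) a; last by [].
apply: aP; split; first exact: dset_setC.
apply: filterS nF => p; have [b ->] := gtype_realized hK p => H.
by exists b => // Db; apply: H; exists b.
Qed.

Lemma compact_Smu : compact [set: Smu S].
Proof.
have <- : (\pi_(quotient_topology {eq_quot (@mu_equiv L S)}) : gtype S -> Smu S) @` setT = setT.
  by apply/seteqP; split=> // x _; have [a ->] := cls_surj hK x; exists (tp a).
apply: continuous_compact compact_gtype.
exact/continuous_subspaceT/pi_continuous.
Qed.

(** Images of definable sets in S^mu_G(M) need not be open; this open set consists of the classes of
    those [a] with mu a inside [D], as [innerP] shows. *)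
Definition inner D : set (Smu S) := ~` (@cls L S @` mulset (mu S) (~` D)).

Lemma open_inner D : dset D -> open (inner D).
Proof.
move=> dD; rewrite openC; apply: (closed_cls hK basis).
by apply: (mu_closed_mulset hK basis); exact: dset_setC.
Qed.

Lemma innerP D (a : G') : dset D -> inner D (cls a) <-> forall m, mu S m -> D (m * a).
Proof.
move=> dD; have [m1 mM mV] := subgroup_mu basis.
have cD := mu_closed_mulset hK basis (dset_setC dD).
rewrite /inner; split=> [H m mm|H /(cls_image hK basis cD)].
  apply: contrapT => nD; apply: H; apply/(cls_image hK basis cD).
  by exists m^-1; [exact: mV|exists (m * a) => //; rewrite mulKg].
move=> [m mm [b nDb bE]]; apply: nDb.
have -> : b = m^-1 * a by rewrite -bE mulKg.
by apply: H; exact: mV.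
Qed.

Lemma inner_sub D (a : G') : dset D -> inner D (cls a) -> D a.
Proof. by move=> dD /(innerP _ dD) /(_ 1); rewrite mul1g; apply; case: (subgroup_mu basis). Qed.

Lemma inner_mulset V X (a : G') : mnbhs V -> dset X -> X a -> inner (mulset V X) (cls a).
Proof.
move=> nV dX Xa; apply/innerP; first exact: dset_mulset nV.1 dX.
by move=> m mm; exists m; [exact: mu_sub mm|exists a].
Qed.

(** The points whose class is outside [O] form a type-definable [F] with [a] not in mu F, so by
    saturation [a] avoids V D for some definable D containing [F]. If X is the complement of V D,
    then V^-1 X misses D. *)
Lemma open_SmuP (O : set (Smu S)) (a : G') : open O -> O (cls a) ->
  exists V X, [/\ mnbhs V, dset X, X a & forall c, mulset V X c -> O (cls c)].
Proof.
move=> oO Oa; have [m1 mM mV] := subgroup_mu basis.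
pose F := [set c : G' | ~ O (cls c)].
have tF : tdset F.
  move=> c H Oc.
  have [D [dD Dc DO]] := @open_gtypeP L S _ c (oO : open (\pi_(quotient_topology _) @^-1` O)) Oc.
  by apply: (H (~` D)) => //; [exact: dset_setC|move=> b Fb /DO].
have nFa : ~ mulset (mu S) F a.
  move=> [m mm [b Fb ba]]; apply: Fb; suff <- : cls a = cls b by [].
  by apply/(cls_eq hK basis); exists m^-1; [exact: mV|exists a => //; rewrite -ba mulKg].
have [V [D [nV dD FD VDa]]] : exists V D, [/\ mnbhs V, dset D, F `<=` D & ~ mulset V D a].
  apply: contrapT => nE; apply: nFa; apply: (mulset_mu_tdset hK) => // V D nV dD FD.
  by apply: contrapT => ?; apply: nE; exists V, D.
have dV := nV.1.
exists (invset V), [set c | ~ exists v, V v /\ D (v^-1 * c)]; split.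
- exact: mnbhsV.
- by rewrite /dset /=; defi.
- by move=> [v [Vv Dv]]; apply: VDa; exists v => //; exists (v^-1 * a) => //; rewrite mulVKg.
- move=> c [w Vw [x nx <-]]; apply: contrapT => /FD Dwx; apply: nx.
  by exists w^-1; rewrite invgK.
Qed.

(** If the classes differ, some V X with [a] in X misses [b]. With V1 V1 inside V, all of mu b
    misses V1 X, so V1 X and its complement yield disjoint neighbourhoods. *)
Lemma hausdorff_Smu : hausdorff_space (Smu S).
Proof.
rewrite open_hausdorff => x y; have [a ->] := cls_surj hK x; have [b ->] := cls_surj hK y.
move=> /eqP ab; have [m1 mM mV] := subgroup_mu basis.
have [V [X [nV dX Xa VXb]]] : exists V X, [/\ mnbhs V, dset X, X a & ~ mulset V X b].
  apply: contrapT => nE; apply: ab; apply/(cls_eq hK basis).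
  apply: (mulset_mu_tdset hK).
    by move=> z H D dD Da; apply: (H D dD) => w; exact.
  move=> V X nV dX aX; apply: contrapT => ?; apply: nE; exists V, X; split => //.
  exact: aX.
have [V1 nV1 V1V] := mnbhs_mul basis nV.
have dVX : dset (mulset V1 X) by exact: dset_mulset nV1.1 dX.
exists (inner (mulset V1 X), inner (~` mulset V1 X)); split.
- by apply/mem_set; exact: inner_mulset.
- apply/mem_set/innerP; first exact: dset_setC.
  move=> m mm [v V1v [x' Xx' vx]]; apply: VXb.
  exists (m^-1 * v); last by exists x' => //; rewrite -mulgA vx mulKg.
  by apply: V1V; exists m^-1; [apply: (mu_sub nV1); exact: mV|exists v].
- exact: open_inner.
- by apply: open_inner; exact: dset_setC.
apply/eqP/seteqP; split=> // z [] /=; have [c ->] := cls_surj hK z.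
by move=> /(inner_sub dVX) H /(inner_sub (dset_setC dVX)).
Qed.

(** If h g^-1 is in V1 and g b is in V1 X, then h b is in V1 V1 X, inside V X. The first condition
    is a neighbourhood of [g], and the second contains one of [x] by means of [inner]. *)
Lemma continuous_Smu_act :
  continuous (fun z : (G * Smu S)%type => Smu_act z.1 z.2).
Proof.
move=> [g x] O; have [a ->] := cls_surj hK x => nO.
have {nO} : nbhs (cls (incl g * a)) O by rewrite -(Smu_actE hK basis).
rewrite nbhsE => -[W [oW Wa] WO].
have [V [X [nV dX Xa VXO]]] := open_SmuP oW Wa.
have [V1 nV1 V1V] := mnbhs_mul basis nV; have dV1 := nV1.1.
pose D := [set y | mulset V1 X (incl g * y)].
have dVX : dset (mulset V1 X) by exact: dset_mulset.
have dD : dset D by rewrite /dset /D /=; defi.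
have Dx : inner D (cls a).
  apply/(innerP _ dD) => m mm; rewrite /D /=.
  exists (incl g * m * (incl g)^-1); first by apply: (mu_sub nV1); exact: mu_conj_incl.
  by exists (incl g * a) => //; rewrite !mulgA mulgVK.
have ng : nbhs g [set h : G | V1 (incl h * (incl g)^-1)].
  have c1 : continuous (fun h : G => h * g^-1).
    move=> h; apply: (@continuous2_cvg _ _ _ _ _ _ id (fun=> g^-1) _ h g^-1).
    - exact: (@mulg_cts G (h, g^-1)).
    - exact: cvg_id.
    - exact: cvg_cst.
  have : nbhs (g * g^-1 : G) [set h | V1 (incl h)] by rewrite mulgV; exact: nV1.2.
  move/c1 => H.
  have {}H : nbhs g ((fun h : G => h * g^-1) @^-1` [set h : G | V1 (incl h)]) by [].
  by apply: filterS H => h /=; rewrite inclM inclV.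
exists ([set h : G | V1 (incl h * (incl g)^-1)], inner D).
  split; first exact: ng.
  by apply: open_nbhs_nbhs; split; [exact: open_inner|exact: Dx].
move=> [h y] /= [V1h]; have [b ->] := cls_surj hK y => /(inner_sub dD) [v V1v [x' Xx' vx]].
apply: WO; rewrite (Smu_actE hK basis); apply: VXO.
exists (incl h * (incl g)^-1 * v); last by exists x' => //; rewrite -mulgA vx mulgA mulgVK.
by apply: V1V; exists (incl h * (incl g)^-1) => //; exists v.
Qed.

Lemma amenable_definably_amenable (R : realType) :
  amenable R (GM S) -> definably_topologically_amenable R S.
Proof.
move=> am; apply: am.
- exact: compact_Smu.
- exact: hausdorff_Smu.
- by move=> x; have [a ->] := cls_surj hK x; rewrite (Smu_actE hK basis) incl1 mul1g.
- move=> g h x; have [a ->] := cls_surj hK x.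
  by rewrite !(Smu_actE hK basis) inclM mulgA.
- exact: continuous_Smu_act.
Qed.

End SmuFlow.

Lemma opens_0definable_basis L (S : defGroup L) : opens_0definable S -> definable_basis S.
Proof.
move=> odef U; rewrite nbhsE => -[W [oW W1] WU].
have [phi WE] := odef W oW.
have E : @defM L S (frename inl phi) = W.
  by rewrite WE; apply/seteqP; split=> g /=; rewrite /defM /= sat_rename.
exists (frename inl phi); rewrite E; last exact: WU.
by exists W.
Qed.

Theorem corollary3p37 (R : realType) (L : signature) (S : defGroup L)
    (K : Type) (hK : monster K S) :
  (definable_basis S -> definably_topologically_amenable R S ->
     G00_top K S = G000_top K S)
  /\
  (opens_0definable S -> amenable R (GM S) ->
     G00_top K S = G000_top K S).
Proof.
have case1 : definable_basis S -> definably_topologically_amenable R S ->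
    G00_top K S = G000_top K S.
  by move=> basis [P P_inv]; exact: (definably_amenable_components_eq hK basis P_inv).
split => // odef am; have basis := opens_0definable_basis odef.
by apply: (case1 basis); exact: (amenable_definably_amenable hK basis).
Qed.
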